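(* Let $S\in\mathbb{S}^d_m$, let $Y\in\mathcal{L}_2(\mathbb{R}^d)$ and suppose that $\nu:=\mathrm{Law}(Y)$ is atomless. Then $$\sup_{X\in\mathcal{X}(Y)}\mathbb{E}[S(X,Y)]=\max_{\gamma\in\Gamma(\nu)}\int S(x,y)\,d\gamma .$$
   Context: $\mathbb{S}^d_m$ denotes the set of symmetric invertible $d\times d$ real matrices with exactly $m\in\{0,1,\dots,d\}$ positive eigenvalues; for such $S$ write $S(x,y):=\langle x,Sy\rangle$, $x,y\in\mathbb{R}^d$. Random variables live on a probability space $(\Omega,\mathcal{F},\mathbb{P})$, relations between them hold a.s., and $\mathcal{L}_2(\mathbb{R}^d)$ is the set of $d$-dimensional random variables with finite second moment. For $Y\in\mathcal{L}_2(\mathbb{R}^d)$, $\mathcal{X}(Y):=\{X\in\mathcal{L}_2(\mathbb{R}^d): X \text{ is } Y\text{-measurable and } \mathbb{E}[Y\mid X]=X\}$. For a Borel probability measure $\nu$ on $\mathbb{R}^d$ with finite second moment, $\Gamma(\nu)$ is the set of Borel probability measures $\gamma$ on $\mathbb{R}^d\times\mathbb{R}^d$ (coordinates $(x,y)$) with finite second moments, whose second marginal is $\nu$, and such that the $\gamma$-conditional expectation of $y$ given $x$ equals $x$. (The maximum on the right-hand side is attained.) *)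

(* Defs.v *)
From HB Require Import structures.
From mathcomp Require Import all_boot all_order all_algebra.
From mathcomp Require Import all_classical all_reals all_analysis.
Set Implicit Arguments. Unset Strict Implicit. Unset Printing Implicit Defensive.
Import Order.TTheory GRing.Theory Num.Theory.
Local Open Scope classical_set_scope.
Local Open Scope ring_scope.

(* R^d is modelled as d.-tuple R with its product (= Borel) sigma-algebra. *)

Definition coord (R : realType) (d : nat) (x : d.-tuple R) (i : 'I_d) : R :=
  tnth x i.

Definition sqnorm (R : realType) (d : nat) (x : d.-tuple R) : R :=
  \sum_(i < d) coord x i ^+ 2.

Definition Sform (R : realType) (d : nat) (S : 'M[R]_d) (x y : d.-tuple R) : R :=
  \sum_(i < d) coord x i * (\sum_(j < d) S i j * coord y j).

(* S is in S^d_m: symmetric, invertible, and exactly m positive eigenvalues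
   (counted with algebraic multiplicity; a real symmetric matrix has a real
   characteristic polynomial that splits over R, so its eigenvalues with
   multiplicity form a list of d reals). *)
Definition sym_inv_index (R : realType) (d m : nat) (S : 'M[R]_d) : Prop :=
  S^T = S /\ S \in unitmx /\
  exists ev : seq R, size ev = d /\
    char_poly S = \prod_(l <- ev) ('X - l%:P) /\
    count (fun l => 0 < l) ev = m.

Definition atomless (R : realType) (d : nat)
    (nu : set (d.-tuple R) -> \bar R) : Prop :=
  forall A : set (d.-tuple R), measurable A -> (0 < nu A)%E ->
    exists2 B : set (d.-tuple R), measurable B /\ B `<=` A &
      (0 < nu B)%E /\ (nu B < nu A)%E.

Section defs.
Context (R : realType) (dO : measure_display) (Omega : measurableType dO)
  (P : probability Omega R) (d : nat).

Definition L2vec (X : Omega -> d.-tuple R) : Prop :=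
  measurable_fun [set: Omega] X /\
  (\int[P]_w (sqnorm (X w))%:E < +oo)%E.

Definition Ymeasurable (X Y : Omega -> d.-tuple R) : Prop :=
  forall B : set (d.-tuple R), measurable B ->
    preimage_set_system [set: Omega] Y measurable (X @^-1` B).

(* E[Y | X] = X a.s., written out as the defining property of the
   conditional expectation given sigma(X) (componentwise) *)
Definition condexp_fixed (X Y : Omega -> d.-tuple R) : Prop :=
  forall (B : set (d.-tuple R)) (i : 'I_d), measurable B ->
    (\int[P]_(w in X @^-1` B) (coord (Y w) i)%:E =
     \int[P]_(w in X @^-1` B) (coord (X w) i)%:E)%E.

Definition Xset (Y : Omega -> d.-tuple R) : set (Omega -> d.-tuple R) :=
  [set X | L2vec X /\ Ymeasurable X Y /\ condexp_fixed X Y].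

Definition law (Y : Omega -> d.-tuple R) : set (d.-tuple R) -> \bar R :=
  pushforward P Y.

End defs.

Definition Gamma (R : realType) (d : nat) (nu : set (d.-tuple R) -> \bar R)
  : set (probability (d.-tuple R * d.-tuple R)%type R) :=
  [set g | (\int[g]_z (sqnorm z.1 + sqnorm z.2)%:E < +oo)%E /\
     (forall B : set (d.-tuple R), measurable B -> g (snd @^-1` B) = nu B) /\
     (forall (B : set (d.-tuple R)) (i : 'I_d), measurable B ->
        (\int[g]_(z in fst @^-1` B) (coord z.2 i)%:E =
         \int[g]_(z in fst @^-1` B) (coord z.1 i)%:E)%E)].

(* Main.v *)
(** Every X in X(Y) gives a law in Gamma(nu), but the converse fails, so two
    facts are needed.

    Density: given gamma in Gamma(nu), round both coordinates to the finitely
    many cells of a dyadic grid.  As nu is atomless, each y-cell splits into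
    pieces carrying exactly the masses gamma(x-cell, y-cell); this labels Y by
    x-cells in a Y-measurable way.  X := E[Y | label] is in X(Y), and the
    martingale property of gamma forces X to be L2-close to the rounded x, so
    that E[X_i Y_j] approximates the integral of x_i y_j.

    Attainment: take X_n in X(Y) with E[S(X_n, Y)] tending to the supremum.
    Encode the signed parts of (X_n, Y) by countably many bits (the dyadic
    threshold events), take ultrafilter limits of the finite joint laws of the
    bits, and realise the limit on [0, 1[ by nested intervals.  The squares
    |X_n|^2 are uniformly integrable since X_n = E[Y | X_n], so decoding the
    limit bits yields (X, Y) on [0, 1[ with E[F(X, Y)] = lim E[F(X_n, Y)] for
    F of pseudo-Lipschitz type.  This covers x_i y_j as well as the test
    functions that determine the law of Y and the martingale property. *)

From Pilot Require Import Defs.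
From HB Require Import structures.
From mathcomp Require Import all_boot all_order all_algebra.
From mathcomp Require Import ring lra.
From mathcomp Require Import all_classical all_reals all_analysis.
From mathcomp Require Import measurable_realfun.
Import Order.TTheory GRing.Theory Num.Theory.
Import numFieldNormedType.Exports.
Local Open Scope classical_set_scope.
Local Open Scope ring_scope.
Set Implicit Arguments.
Unset Strict Implicit.
Unset Printing Implicit Defensive.

Section expectation.
Context {dT : measure_display} {T : measurableType dT} {R : realType}.
Variable P : probability T R.
Implicit Types (f g h : T -> R) (A : set T).

Definition itg f := P.-integrable setT (EFin \o f).

Definition Ex f : R := \int[P]_x f x.

Definition L2 f := measurable_fun setT f /\ itg (fun x => f x ^+ 2).

Lemma ExE f : itg f -> (\int[P]_x (f x)%:E = (Ex f)%:E)%E.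
Proof. by move=> itf; rewrite /Ex /Rintegral fineK//; exact: integrable_fin_num. Qed.

Lemma itg_measurable f : itg f -> measurable_fun setT f.
Proof. by move=> /measurable_int /measurable_EFinP. Qed.

Lemma itg_dom f g : itg g -> measurable_fun setT f ->
  (forall x, `|f x| <= g x) -> itg f.
Proof.
move=> ig mf fg; apply: (le_integrable _ _ _ ig) => //; first exact/measurable_EFinP.
by move=> x _ /=; rewrite lee_fin (le_trans (fg x)) ?ler_norm.
Qed.

Lemma itg_eq f g : f =1 g -> itg f -> itg g.
Proof. by move=> /funext ->. Qed.

Lemma itg_cst c : itg (fun=> c).
Proof. exact: finite_measure_integrable_cst. Qed.

Lemma itg_bounded f c : measurable_fun setT f -> (forall x, `|f x| <= c) -> itg f.
Proof. by exact: itg_dom (itg_cst c). Qed.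

Lemma itgD f g : itg f -> itg g -> itg (fun x => f x + g x).
Proof. by move=> fi gi; have := integrableD measurableT fi gi. Qed.

Lemma itgB f g : itg f -> itg g -> itg (fun x => f x - g x).
Proof. by move=> fi gi; have := integrableB measurableT fi gi. Qed.

Lemma itgZ c f : itg f -> itg (fun x => c * f x).
Proof. by move=> fi; have := integrableZl measurableT c fi. Qed.

Lemma itg_sum (I : Type) (s : seq I) (F : I -> T -> R) :
  (forall i, itg (F i)) -> itg (fun x => \sum_(i <- s) F i x).
Proof.
move=> Fi; elim: s => [|i s ih].
  by apply: itg_eq (itg_cst 0) => x; rewrite big_nil.
by apply: itg_eq (itgD (Fi i) ih) => x; rewrite big_cons.
Qed.

Lemma itg_norm f : itg f -> itg (fun x => `|f x|).
Proof. exact: integrable_norm. Qed.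

Lemma itg_sqrM f g : L2 f -> L2 g -> itg (fun x => f x * g x).
Proof.
move=> [mf fi] [mg gi]; apply: (itg_dom (itgD fi gi)).
  exact: measurable_funM.
by move=> x; rewrite ler_norml; apply/andP; split; nra.
Qed.

Lemma ExD f g : itg f -> itg g -> Ex (fun x => f x + g x) = Ex f + Ex g.
Proof. by move=> fi gi; exact: RintegralD. Qed.

Lemma ExB f g : itg f -> itg g -> Ex (fun x => f x - g x) = Ex f - Ex g.
Proof. by move=> fi gi; exact: RintegralB. Qed.

Lemma ExZ c f : itg f -> Ex (fun x => c * f x) = c * Ex f.
Proof. by move=> fi; exact: RintegralZl. Qed.

Lemma Ex_cst c : Ex (fun=> c) = c.
Proof.
rewrite /Ex Rintegral_cst//; have /= -> := probability_setT P.
by rewrite mulr1.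
Qed.

Lemma Ex_eq f g : f =1 g -> Ex f = Ex g.
Proof. by move=> /funext ->. Qed.

Lemma Ex_sum (I : Type) (s : seq I) (F : I -> T -> R) :
  (forall i, itg (F i)) ->
  Ex (fun x => \sum_(i <- s) F i x) = \sum_(i <- s) Ex (F i).
Proof.
move=> Fi; elim: s => [|i s ih].
  by rewrite big_nil -[RHS]Ex_cst; apply: Ex_eq => x; rewrite big_nil.
rewrite big_cons -ih -ExD//; last exact: itg_sum.
by apply: Ex_eq => x; rewrite big_cons.
Qed.

Lemma Ex_le f g : itg f -> itg g -> (forall x, f x <= g x) -> Ex f <= Ex g.
Proof. by move=> fi gi fg; apply: le_Rintegral => // x _. Qed.

Lemma Ex_ge0 f : (forall x, 0 <= f x) -> 0 <= Ex f.
Proof. by move=> f0; apply: Rintegral_ge0 => x _. Qed.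

Lemma Ex_norm f : itg f -> `|Ex f| <= Ex (fun x => `|f x|).
Proof. by move=> fi; exact: le_normr_Rintegral. Qed.

Lemma Ex_indic A : measurable A -> Ex \1_A = fine (P A).
Proof. by move=> mA; rewrite /Ex /Rintegral integral_indic// setIT. Qed.

Lemma Ex_setI A f : (\int[P]_(x in A) f x)%R = Ex (fun x => \1_A x * f x).
Proof.
rewrite Rintegral_mkcond /Ex; apply: eq_Rintegral => x _.
by rewrite /patch indicE; case: ifP => _; rewrite ?mul1r ?mul0r.
Qed.

Lemma itg_indicM A f : measurable A -> itg f -> itg (fun x => \1_A x * f x).
Proof.
move=> mA fi; apply: (itg_dom (itg_norm fi)).
  by apply: measurable_funM; [exact: measurable_indic|exact: itg_measurable].
move=> x; rewrite indicE normrM ger0_norm// ler_piMl//.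
by case: (x \in A).
Qed.

Lemma L2_measurable f : L2 f -> measurable_fun setT f.
Proof. by case. Qed.

Lemma L2_cst c : L2 (fun=> c).
Proof. by split => //; exact: itg_cst. Qed.

Lemma L2_itg f : L2 f -> itg f.
Proof.
move=> fL; apply: itg_eq (itg_sqrM fL (L2_cst 1)) => x; by rewrite mulr1.
Qed.

Lemma L2_dom f g : L2 g -> measurable_fun setT f ->
  (forall x, `|f x| <= `|g x|) -> L2 f.
Proof.
move=> [mg gi] mf fg; split=> //; apply: (itg_dom gi); first exact: measurable_funX.
by move=> x; rewrite normrX -(real_normK (num_real (g x))) lerXn2r ?nnegrE.
Qed.

Lemma L2_bounded f c : measurable_fun setT f -> (forall x, `|f x| <= c) -> L2 f.
Proof.
move=> mf fc; apply: (L2_dom (L2_cst c) mf) => x.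
by rewrite (le_trans (fc x))// ler_norm.
Qed.

Lemma L2D f g : L2 f -> L2 g -> L2 (fun x => f x + g x).
Proof.
move=> fL gL; split; first exact: measurable_funD (L2_measurable fL) (L2_measurable gL).
apply: itg_eq (itgD (itgD fL.2 gL.2) (itgZ 2 (itg_sqrM fL gL))) => x; ring.
Qed.

Lemma L2Z c f : L2 f -> L2 (fun x => c * f x).
Proof.
move=> fL; split; first exact: measurable_funM (L2_measurable (L2_cst c)) (L2_measurable fL).
by apply: itg_eq (itgZ (c ^+ 2) fL.2) => x; rewrite exprMn.
Qed.

Lemma L2_eq f g : f =1 g -> L2 f -> L2 g.
Proof. by move=> /funext ->. Qed.

Lemma L2B f g : L2 f -> L2 g -> L2 (fun x => f x - g x).
Proof.
move=> fL gL; apply: L2_eq (L2D fL (L2Z (-1) gL)) => x; by rewrite mulN1r.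
Qed.

Lemma L2_sum (I : Type) (s : seq I) (F : I -> T -> R) :
  (forall i, L2 (F i)) -> L2 (fun x => \sum_(i <- s) F i x).
Proof.
move=> Fi; elim: s => [|i s ih].
  by apply: L2_eq (L2_cst 0) => x; rewrite big_nil.
by apply: L2_eq (L2D (Fi i) ih) => x; rewrite big_cons.
Qed.

Lemma Ex_sqr_ge0 f : 0 <= Ex (fun x => f x ^+ 2).
Proof. by apply: Ex_ge0 => x; exact: sqr_ge0. Qed.

Lemma Ex_amgm f g c : 0 < c -> L2 f -> L2 g ->
  `|Ex (fun x => f x * g x)| <=
  c * Ex (fun x => f x ^+ 2) + c^-1 * Ex (fun x => g x ^+ 2).
Proof.
move=> c0 fL gL; apply: (le_trans (Ex_norm (itg_sqrM fL gL))).
have [fi gi] := (itgZ c fL.2, itgZ c^-1 gL.2).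
rewrite -ExZ ?fL.2// -ExZ ?gL.2// -ExD//; apply: Ex_le.
- exact/itg_norm/itg_sqrM.
- exact: itgD.
move=> x; have c'0 : 0 < c^-1 by rewrite invr_gt0.
have cc : c * c^-1 = 1 by rewrite divff// gt_eqF.
have h : 0 <= (c * f x - g x) ^+ 2 by exact: sqr_ge0.
have h' : 0 <= (c * f x + g x) ^+ 2 by exact: sqr_ge0.
have e (s : R) : c * f x ^+ 2 + c^-1 * g x ^+ 2 - s * (f x * g x) =
  c^-1 * ((c * f x) ^+ 2 + g x ^+ 2 - s * (c * f x * g x)).
  by field; rewrite gt_eqF.
rewrite ler_norml; apply/andP; split; rewrite -subr_ge0.
- rewrite opprK addrC -[f x * g x]opprK -[- (f x * g x)]mulN1r e.
  by apply: mulr_ge0; [exact: ltW|nra].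
- by rewrite -[f x * g x]mul1r e; apply: mulr_ge0; [exact: ltW|nra].
Qed.

End expectation.

Section rounding.
Context {R : realType}.
Implicit Types (t : R) (k : nat).

Definition rbit k j t : bool := j.+1%:R * 2 ^- k <= t.

Definition rnd k t : R := 2 ^- k * \sum_(j < 4 ^ k) (rbit k j t)%:R.

Lemma count_le_floor (s : R) n : 0 <= s ->
  [/\ \sum_(j < n) (rbit 0 j s)%:R <= s :> R,
      \sum_(j < n) (rbit 0 j s)%:R <= n%:R :> R &
      s <= n%:R -> s <= \sum_(j < n) (rbit 0 j s)%:R + 1 :> R].
Proof.
move=> s0; set c := \sum_(j < n) _.
suff : (n%:R <= s /\ c = n%:R) \/ [/\ s < n%:R, s - 1 <= c & c <= s].
  move=> [[ns ->]|[sn sc cs]]; split=> //; lra.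
rewrite {}/c; elim: n => [|n ih]; first by left; rewrite big_ord0.
rewrite big_ord_recr/=; set c := \sum_(i < n) _ in ih *.
have nS : n.+1%:R = n%:R + 1 :> R by rewrite -natr1.
rewrite /rbit expr0 invr1 mulr1.
case: ih => [[ns cn]|[sn sc cs]]; last first.
  have /lt_geF -> : s < n.+1%:R by rewrite nS; lra.
  by right; rewrite addr0 nS; split; lra.
have [ns1|sn1] := leP n.+1%:R s; first by left; rewrite cn nS.
by right; rewrite addr0 nS cn in sn1 *; split; lra.
Qed.

Lemma rnd_scaleE k t :
  rnd k t = 2 ^- k * \sum_(j < 4 ^ k) (rbit 0 j (2 ^+ k * t))%:R.
Proof.
congr (_ * _); apply: eq_bigr => j _; rewrite /rbit expr0 invr1 mulr1.
by rewrite ler_pdivrMr ?exprn_gt0// [_ * t]mulrC.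
Qed.

Lemma rnd_ge0 k t : 0 <= rnd k t.
Proof. by rewrite mulr_ge0 ?invr_ge0 ?exprn_ge0// sumr_ge0. Qed.

Let scale_ge0 k t : 0 <= t -> 0 <= 2 ^+ k * t.
Proof. by move=> t0; rewrite mulr_ge0// exprn_ge0. Qed.

Let pow4 k : (4 ^ k)%:R = 2 ^+ k * 2 ^+ k :> R.
Proof. by rewrite natrX -exprMn -natrM. Qed.

Lemma rnd_le k t : 0 <= t -> rnd k t <= t.
Proof.
move=> t0; rewrite rnd_scaleE ler_pdivrMl ?exprn_gt0//.
by have [] := count_le_floor (4 ^ k) (scale_ge0 k t0).
Qed.

Lemma rnd_le_bound k t : 0 <= t -> rnd k t <= 2 ^+ k.
Proof.
move=> t0; rewrite rnd_scaleE ler_pdivrMl ?exprn_gt0// -pow4.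
by have [] := count_le_floor (4 ^ k) (scale_ge0 k t0).
Qed.

Lemma rnd_close k t : 0 <= t <= 2 ^+ k -> t <= rnd k t + 2 ^- k.
Proof.
move=> /andP[t0 tk]; rewrite rnd_scaleE -[X in _ + X]mulr1 -mulrDr.
rewrite ler_pdivlMl ?exprn_gt0//.
have [_ _] := count_le_floor (4 ^ k) (scale_ge0 k t0).
by apply; rewrite pow4 ler_pM2l ?exprn_gt0.
Qed.

Lemma rnd_err k t : 0 <= t ->
  (t - rnd k t) ^+ 2 <= 2 ^- k + (if t <= 2 ^+ k then 0 else t ^+ 2).
Proof.
move=> t0; have := rnd_ge0 k t; have := rnd_le k t0.
have c0 : 0 < 2 ^- k :> R by rewrite invr_gt0 exprn_gt0.
case: ifPn => [tk rt r0|tk rt r0]; last by nra.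
rewrite addr0; have : 0 <= t <= 2 ^+ k by rewrite t0.
move=> /rnd_close.
have : 2 ^- k <= 1 :> R by rewrite invf_le1 ?exprn_gt0// exprn_ege1// ler1n.
by move: (2 ^- k) c0 => c *; nra.
Qed.

Lemma rnd_mono k t : rnd k t <= rnd k.+1 t.
Proof.
have sum2 (f : nat -> R) n : \sum_(j < n.*2) f j = \sum_(j < n) (f j.*2 + f j.*2.+1).
  elim: n => [|n ih]; first by rewrite !big_ord0.
  by rewrite doubleS !big_ord_recr/= ih addrA.
have bitE j : rbit k.+1 j.*2.+1 t = rbit k j t.
  by rewrite /rbit -doubleS -muln2 natrM exprS invfM mulrA mulfK.
have bitW j : (rbit k j t <= rbit k.+1 j.*2 t)%N.
  rewrite -bitE; case: (boolP (rbit k.+1 j.*2.+1 t)) => // h.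
  by rewrite /rbit (le_trans _ h)// ler_wpM2r ?invr_ge0 ?exprn_ge0// ler_nat.
rewrite /rnd exprS invfM expnS (_ : 4 * 4 ^ k = (2 * 4 ^ k).*2)%N; last first.
  by rewrite -mul2n mulnA.
rewrite (sum2 (fun j => (rbit k.+1 j t)%:R)).
rewrite [2^-1 * _]mulrC -mulrA ler_pM2l ?invr_gt0 ?exprn_gt0// ler_pdivlMl//.
apply: (@le_trans _ _ (2 * \sum_(j < 2 * 4 ^ k) (rbit k j t)%:R)).
  rewrite ler_pM2l//.
  rewrite (big_ord_widen _ (fun j => (rbit k j t)%:R : R)
    (leq_pmull (4 ^ k) (isT : 0 < 2)%N)).
  by rewrite big_mkcond/=; apply: ler_sum => j _; case: ifP.
rewrite mulr_sumr; apply: ler_sum => j _.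
by rewrite bitE mulr_natl mulr2n lerD2r ler_nat.
Qed.

Lemma rnd_monoW j k t : (j <= k)%N -> rnd j t <= rnd k t.
Proof.
move=> /subnK <-; elim: (k - j)%N => [//|n ih].
by rewrite addSn (le_trans ih)// rnd_mono.
Qed.

Lemma rnd_cvg t : 0 <= t -> rnd k t @[k --> \oo] --> t.
Proof.
move=> t0; have h2 : t - 2^-1 ^+ n @[n --> \oo] --> t.
  rewrite -[X in _ --> X]subr0; apply: cvgB; first exact: cvg_cst.
  by apply: cvg_expr; rewrite ger0_norm ?invr_ge0// invf_lt1// ltr1n.
apply: (@squeeze_cvgr _ _ _ _ _ (fun=> t) _ _ _ h2); last exact: cvg_cst.
exists (Num.Def.archi_bound t) => // n /= /Num.Theory.upper_nthrootP tn.
by rewrite rnd_le// andbT lerBlDr exprVn rnd_close// t0 ltW.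
Qed.

End rounding.

Lemma measurable_bool_set dT (T : measurableType dT) (b : T -> bool) :
  measurable_fun setT b -> measurable [set x | b x].
Proof.
move=> mb; have m1 : measurable [set true] by [].
by have := mb measurableT _ m1; rewrite setTI.
Qed.

Lemma measurable_boolr {R : realType} dT (T : measurableType dT) (b : T -> bool) :
  measurable_fun setT b -> measurable_fun setT (fun x => (b x)%:R : R).
Proof.
move=> mb; have := measurable_fun_ifT mb (measurable_cst (1 : R)) (measurable_cst (0 : R)).
by congr measurable_fun; apply/funext => x; case: (b x).
Qed.

Lemma measurable_rbit {R : realType} dT (T : measurableType dT) (f : T -> R) k j :
  measurable_fun setT f -> measurable_fun setT (fun x => rbit k j (f x)).
Proof. by move=> mf; exact: measurable_fun_ler. Qed.

Lemma measurable_rnd {R : realType} dT (T : measurableType dT) (f : T -> R) k :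
  measurable_fun setT f -> measurable_fun setT (fun x => rnd k (f x)).
Proof.
move=> mf; apply: measurable_funM => //; apply: measurable_sum => j.
exact/measurable_boolr/measurable_rbit.
Qed.

Section rounding_expectation.
Context {dT : measure_display} {T : measurableType dT} {R : realType}.
Variable P : probability T R.
Implicit Types f g : T -> R.

Lemma Ex_dominated_cvg (F : nat -> T -> R) f g : itg P g ->
  (forall n, measurable_fun setT (F n)) ->
  (forall x, F n x @[n --> \oo] --> f x) ->
  (forall n x, `|F n x| <= g x) ->
  Ex P (F n) @[n --> \oo] --> Ex P f.
Proof.
move=> gi mF Ff Fg; have mf : measurable_fun setT f.
  by apply: (@measurable_fun_cvg _ _ _ _ F) => // x _; exact: Ff.
have fi : itg P f.
  apply: (itg_dom gi mf) => x.
  have /cvg_lim <- // : `|F n x| @[n --> \oo] --> `|f x| by apply: cvg_norm.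
  apply: limr_le; last by apply: nearW => n; exact: Fg.
  by apply/cvg_ex; exists `|f x|; exact: cvg_norm.
suff /fine_cvgP[] : (\int[P]_x (F n x)%:E @[n --> \oo] --> (Ex P f)%:E)%E by [].
rewrite -ExE//.
apply: (@dominated_cvg _ _ _ P _ measurableT _ _ (EFin \o g)) => //.
- by move=> n; exact/measurable_EFinP.
- by move=> x _; apply: cvg_EFin; [exact: nearW|exact: Ff].
- by move=> n x _; rewrite /= lee_fin.
Qed.

Lemma Ex_rnd_cvg f g : measurable_fun setT f -> measurable_fun setT g ->
  (forall x, 0 <= g x) -> itg P (fun x => f x * g x) ->
  Ex P (fun x => f x * rnd k (g x)) @[k --> \oo] --> Ex P (fun x => f x * g x).
Proof.
move=> mf mg g0 fgi; apply: (Ex_dominated_cvg (itg_norm fgi)).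
- by move=> k; apply: measurable_funM => //; exact: measurable_rnd.
- by move=> x; apply: cvgMl_tmp; exact: rnd_cvg.
- move=> k x; rewrite (normrM _ (rnd _ _)) (normrM _ (g x)) ler_wpM2l// !ger0_norm ?rnd_ge0//.
  exact: rnd_le.
Qed.

Lemma L2_rnd k g : L2 P g -> (forall x, 0 <= g x) -> L2 P (fun x => rnd k (g x)).
Proof.
move=> gL g0; apply: (L2_dom gL); first exact: measurable_rnd (L2_measurable gL).
by move=> x; rewrite !ger0_norm ?rnd_ge0// rnd_le.
Qed.

Lemma Ex_rnd_sqr_cvg g : L2 P g -> (forall x, 0 <= g x) ->
  Ex P (fun x => (g x - rnd k (g x)) ^+ 2) @[k --> \oo] --> 0.
Proof.
move=> gL g0; have rL k := L2_rnd k gL g0.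
have mg := L2_measurable gL.
rewrite -(Ex_cst P 0); apply: (Ex_dominated_cvg gL.2).
- by move=> k; apply: measurable_funX; apply: measurable_funB => //; exact: measurable_rnd.
- move=> x; have gr : g x - rnd k (g x) @[k --> \oo] --> 0.
    by rewrite -(subrr (g x)); apply: cvgB; [exact: cvg_cst|exact: rnd_cvg].
  by rewrite -[0](mulr0 0); exact: cvgM.
- move=> k x; rewrite ger0_norm ?sqr_ge0//.
  by have := rnd_ge0 k (g x); have := rnd_le k (g0 x); have := g0 x; nra.
Qed.

End rounding_expectation.

Definition bounded_seq {R : realType} (a : nat -> R) := exists M, forall n, `|a n| <= M.

Record is_generalized_limit {R : realType} (L : (nat -> R) -> R) : Prop := {
  glimD : forall a b, bounded_seq a -> bounded_seq b ->
    L (fun n => a n + b n) = L a + L b;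
  glimZ : forall c a, bounded_seq a -> L (fun n => c * a n) = c * L a;
  glim_le : forall a b, bounded_seq a -> bounded_seq b ->
    (forall n, a n <= b n) -> L a <= L b;
  glim_cvg : forall a l, a @ \oo --> l -> L a = l }.

Lemma generalized_limit_exists (R : realType) :
  exists L : (nat -> R) -> R, is_generalized_limit L.
Proof.
have [U [UF oU]] := ultraFilterLemma (@eventually_filter).
have PU : ProperFilter U by exact: ultra_proper.
have cvU (a : nat -> R) : bounded_seq a -> cvg (a @ U).
  move=> [M aM].
  have cM : compact (`[- M, M] : set R) by exact: segment_compact.
  have UaF : ProperFilter (a @ U) by exact: fmap_proper_filter.
  have [G [GU aG]] := ultraFilterLemma UaF.
  have GM : G `[- M, M]%classic.
    by apply: aG; apply: nearW => n /=; rewrite in_itv/= -ler_norml.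
  move: cM; rewrite compact_ultra => /(_ G GU GM)[l [_ Gl]].
  apply/cvg_ex; exists l => A Al.
  have [//|UC] := in_ultra_setVsetC (a @^-1` A) UF.
  have GA : G A by exact: Gl.
  have GAC : G (~` A) by exact: aG.
  by have /filter_ex[x []] : G (A `&` ~` A) by exact: filterI.
exists (fun a => lim (a @ U)); split.
- by move=> a b /cvU ca /cvU cb; apply: cvg_lim => //; exact: cvgD.
- by move=> c a /cvU ca; apply: cvg_lim => //; apply: cvgMl_tmp.
- by move=> a b /cvU ca /cvU cb ab; apply: ler_lim => //; exact: nearW.
- move=> a l al; apply: cvg_lim => //; apply: cvg_trans al => A.
  exact: oU.
Qed.

Section generalized_limit.
Context {R : realType} (L : (nat -> R) -> R) (HL : is_generalized_limit L).

Lemma bounded_seqD (a b : nat -> R) :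
  bounded_seq a -> bounded_seq b -> bounded_seq (fun n => a n + b n).
Proof.
move=> [M aM] [N bN]; exists (M + N) => n.
by rewrite (le_trans (ler_normD _ _))// lerD.
Qed.

Lemma bounded_seqZ c (a : nat -> R) : bounded_seq a -> bounded_seq (fun n => c * a n).
Proof. by move=> [M aM]; exists (`|c| * M) => n; rewrite normrM ler_wpM2l. Qed.

Lemma bounded_seq_cst (c : R) : bounded_seq (fun=> c).
Proof. by exists `|c|. Qed.

Lemma bounded_seq_sum (I : Type) (s : seq I) (a : I -> nat -> R) :
  (forall i, bounded_seq (a i)) -> bounded_seq (fun n => \sum_(i <- s) a i n).
Proof.
move=> aM; elim: s => [|j s ih]; first by exists 0 => n; rewrite big_nil normr0.
by under eq_fun do rewrite big_cons; exact: bounded_seqD.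
Qed.

Lemma glim_cst c : L (fun=> c) = c.
Proof. by apply: (glim_cvg HL); exact: cvg_cst. Qed.

Lemma glim_sum (I : Type) (s : seq I) (a : I -> nat -> R) :
  (forall i, bounded_seq (a i)) ->
  L (fun n => \sum_(i <- s) a i n) = \sum_(i <- s) L (a i).
Proof.
move=> aM; elim: s => [|i s ih].
  rewrite big_nil -[RHS]glim_cst; congr L; apply/funext => n; by rewrite big_nil.
rewrite big_cons -ih -(glimD HL)//; last exact: bounded_seq_sum.
by congr L; apply/funext => n; rewrite big_cons.
Qed.

Lemma glim_dist (a b : nat -> R) e : bounded_seq a -> bounded_seq b ->
  (forall n, `|a n - b n| <= e) -> `|L a - L b| <= e.
Proof.
move=> aM bM ab; have eM := bounded_seq_cst e.
have h (x y : nat -> R) : bounded_seq x -> bounded_seq y ->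
    (forall n, x n - y n <= e) -> L x - L y <= e.
  move=> xM yM xy; rewrite lerBlDl -(glim_cst e) -(glimD HL)//.
  apply: (glim_le HL) => //; first exact: bounded_seqD.
  by move=> n; rewrite -lerBlDl.
rewrite ler_norml lerNl opprB !h// => n.
  by rewrite (le_trans _ (ab n))// ler_norm.
by rewrite (le_trans _ (ab n))// distrC ler_norm.
Qed.

End generalized_limit.

Section uniform01.
Context {R : realType}.

Definition unif : probability (measurableTypeR R) R := uniform_prob (@ltr01 R).

Lemma unif_setI01 (A : set R) : measurable A ->
  unif A = lebesgue_measure (A `&` `[0, 1]%classic).
Proof.
move=> mA; rewrite /unif /= /uniform_prob integral_uniform_pdf.
rewrite (eq_integral (cst 1%E)); last first.
  by move=> x; rewrite inE/= in_itv/= /uniform_pdf => -[_ ->]; rewrite subr0 invr1.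
by rewrite integral_cst/= ?mul1e//; exact: measurableI.
Qed.

Lemma unif_itv (a b : R) : 0 <= a -> a <= b -> b <= 1 -> unif `[a, b[%classic = (b - a)%:E.
Proof.
move=> a0 ab b1; rewrite unif_setI01// (_ : _ `&` _ = `[a, b[%classic).
  rewrite lebesgue_measure_itv/= lte_fin; case: ltP => // ba.
  by rewrite (_ : b - a = 0)//; apply/eqP; rewrite subr_eq0 eq_le ba ab.
apply/seteqP; split=> x /=; rewrite !in_itv/=; first by case.
by move=> /andP[ax xb]; split; apply/andP; split => //; lra.
Qed.

Lemma unif_eq (A B : set R) : measurable A -> measurable B ->
  A `&` `[0, 1[%classic = B `&` `[0, 1[%classic -> unif A = unif B.
Proof.
move=> mA mB AB; have C0 : unif (~` `[0, 1[%classic) = 0%E.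
  rewrite probability_setC// -[X in (_ - X)%E](_ : 1%E = _) ?subee//.
  by rewrite unif_itv// subr0.
have E (C : set R) : measurable C -> unif C = unif (C `&` `[0, 1[%classic).
  move=> mC; rewrite [in LHS](_ : C = (C `&` `[0, 1[%classic) `|` (C `&` ~` `[0, 1[%classic)).
    have mI : measurable (C `&` ~` `[0, 1[%classic).
      by apply: measurableI => //; exact: measurableC.
    rewrite measureU//; last 2 first.
    - exact: measurableI.
    - by rewrite setIACA setICr setI0.
    rewrite [X in (_ + X)%E](_ : _ = 0%E) ?adde0//.
    apply/eqP; rewrite eq_le measure_ge0 andbT -C0 le_measure// ?inE//.
    exact: measurableC.
  by rewrite -setIUr setUCr setIT.
by rewrite E// AB -E.
Qed.

End uniform01.

Section binary_tree.
Context {R : realType} (p : seq bool -> R).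
Hypothesis p_ge0 : forall s, 0 <= p s.
Hypothesis p_nil : p [::] = 1.
Hypothesis p_split : forall s, p s = p (false :: s) + p (true :: s).

(* Words list the bits backwards, the most recent one first; the words of a
   given length cut [0, 1[ into consecutive intervals [lo s, lo s + p s[. *)
Fixpoint lo (s : seq bool) : R :=
  if s is b :: s' then lo s' + (if b then p (false :: s') else 0) else 0.

Fixpoint word_of (u : R) (n : nat) : seq bool :=
  if n is n'.+1 then
    let s := word_of u n' in (lo s + p (false :: s) <= u) :: s
  else [::].

Lemma word_of_itv u s : 0 <= u < 1 ->
  (word_of u (size s) == s) = (lo s <= u < lo s + p s).
Proof.
move=> u01; elim: s => [|b s ih] /=; first by rewrite eqxx p_nil add0r.
rewrite eqseq_cons andbC; have [es|nes] := boolP (word_of u (size s) == s).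
  rewrite (eqP es) andTb; move: ih; rewrite es => /esym/andP[].
  rewrite (p_split s) => lu ul.
  case: (leP (lo s + p (false :: s)) u) => h; case: b => /=.
  - by apply/esym/andP; split; lra.
  - by apply/esym/negbTE/negP => /andP[_]; lra.
  - by apply/esym/negbTE/negP => /andP[]; lra.
  - by apply/esym/andP; split; lra.
rewrite andFb; move: ih; rewrite (negbTE nes) => /esym/negbT h.
apply/esym/negbTE; apply: contra h; have := p_ge0 (false :: s); have := p_ge0 (true :: s).
by rewrite (p_split s); case: b => /= ? ? /andP[? ?]; apply/andP; split; lra.
Qed.

End binary_tree.

Section finite_prefix.

Fixpoint prefix_word (b : nat -> bool) (n : nat) : seq bool :=
  if n is n'.+1 then b n' :: prefix_word b n' else [::].

Definition bits_of_word (s : seq bool) : nat -> bool := nth false (rev s).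

Lemma size_prefix_word b n : size (prefix_word b n) = n.
Proof. by elim: n => //= n ->. Qed.

Lemma bits_of_prefix_word b n j : (j < n)%N -> bits_of_word (prefix_word b n) j = b j.
Proof.
rewrite /bits_of_word; elim: n => // n ih; rewrite ltnS rev_cons nth_rcons.
rewrite size_rev size_prefix_word leq_eqVlt => /predU1P[->|jn]; first by rewrite ltnn eqxx.
by rewrite jn ih.
Qed.

Definition prefix_dep {R : Type} (m : nat) (G : (nat -> bool) -> R) :=
  forall b b', (forall j, (j < m)%N -> b j = b' j) -> G b = G b'.

Lemma prefix_depE {R : realType} m (G : (nat -> bool) -> R) b : prefix_dep m G ->
  G b = \sum_(s : m.-tuple bool)
          G (bits_of_word s) * (prefix_word b (size s) == s)%:R.
Proof.
move=> Gm; have sz : size (prefix_word b m) == m by rewrite size_prefix_word.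
rewrite (bigD1 (Tuple sz))//= size_prefix_word eqxx mulr1 big1 ?addr0.
  by apply: Gm => j jm; rewrite bits_of_prefix_word.
move=> s /eqP sn; rewrite size_tuple; case: eqP => [bs|]; last by rewrite mulr0.
by exfalso; apply: sn; apply: val_inj.
Qed.

Context {dT : measure_display} {T : measurableType dT} {R : realType}.
Variable P : probability T R.
Variable c : T -> nat -> bool.
Hypothesis mc : forall j, measurable_fun setT (c ^~ j).

Lemma measurable_prefix_word s :
  measurable_fun setT (fun x => prefix_word (c x) (size s) == s).
Proof.
elim: s => [|b s ih] /=; first exact: measurable_cst.
under eq_fun do rewrite eqseq_cons.
apply: measurable_and => //; have mcs := mc (size s); case: b.
  by under eq_fun do rewrite eqb_id.
by under eq_fun do rewrite eqbF_neg; exact: measurable_neg.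
Qed.

Lemma itg_prefix_word s : itg P (fun x => (prefix_word (c x) (size s) == s)%:R).
Proof.
apply: (@itg_bounded _ _ _ _ _ 1); first exact/measurable_boolr/measurable_prefix_word.
by move=> x; case: eqP; rewrite ?normr1 ?normr0.
Qed.

Variables (m : nat) (G : (nat -> bool) -> R).
Hypothesis Gm : prefix_dep m G.

Let prefix_depE_comp : G \o c = fun x => \sum_(s : m.-tuple bool)
  G (bits_of_word s) * (prefix_word (c x) (size s) == s)%:R.
Proof. by apply/funext => x; exact: prefix_depE. Qed.

Lemma itg_prefix_dep : itg P (G \o c).
Proof.
by rewrite prefix_depE_comp; apply: itg_sum => s; exact/itgZ/itg_prefix_word.
Qed.

Lemma Ex_prefix_dep : Ex P (G \o c) =
  \sum_(s : m.-tuple bool)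
     G (bits_of_word s) * Ex P (fun x => (prefix_word (c x) (size s) == s)%:R).
Proof.
rewrite prefix_depE_comp Ex_sum; last by move=> s; exact/itgZ/itg_prefix_word.
by apply: eq_bigr => s _; rewrite ExZ//; exact: itg_prefix_word.
Qed.

End finite_prefix.

Lemma limit_bits {R : realType} (L : (nat -> R) -> R) :
  is_generalized_limit L ->
  forall (dT : measure_display) (T : measurableType dT) (P : probability T R)
    (c : nat -> T -> nat -> bool),
  (forall n j, measurable_fun setT (c n ^~ j)) ->
  exists2 b : measurableTypeR R -> nat -> bool, (forall j, measurable_fun setT (b ^~ j)) &
  forall m (G : (nat -> bool) -> R), prefix_dep m G ->
    Ex unif (G \o b) = L (fun n => Ex P (G \o c n)).
Proof.
move=> HL dT T P c mc.
pose a s n := Ex P (fun x => (prefix_word (c n x) (size s) == s)%:R).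
pose p s := L (a s).
have ita s n := itg_prefix_word P (mc n) s.
have aM s : bounded_seq (a s).
  exists 1 => n; rewrite ger0_norm; last exact: Ex_ge0.
  rewrite -(Ex_cst P 1); apply: Ex_le => //; first exact: itg_cst.
  by move=> x; case: eqP.
have p0 s : 0 <= p s.
  rewrite -(glim_cst HL 0); apply: (glim_le HL) => //; first exact: bounded_seq_cst.
  by move=> n; exact: Ex_ge0.
have p1 : p [::] = 1.
  by rewrite -(glim_cst HL 1); congr L; apply/funext => n; rewrite /a /= Ex_cst.
have pS s : p s = p (false :: s) + p (true :: s).
  rewrite /p -(glimD HL)//; congr L; apply/funext => n; rewrite /a -ExD//.
  apply: Ex_eq => x /=; rewrite !eqseq_cons.
  by case: (c n x _); case: eqP => _; rewrite ?addr0 ?add0r.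
pose w (u : measurableTypeR R) := word_of p u; pose b u j := head false (w u j.+1).
have bw u n : prefix_word (b u) n = w u n.
  by elim: n => //= n ->.
have mb j : measurable_fun setT (b ^~ j).
  suff mw n (F : seq bool -> R) : measurable_fun setT (fun u => F (w u n)).
    by apply: measurable_fun_ler => //=; exact: (mw _ (fun s => lo p s + p (false :: s))).
  elim: n F => [|n ih] F; first exact: (measurable_cst (F [::])).
  rewrite (_ : (fun u => _) = (fun u => if lo p (w u n) + p (false :: w u n) <= u
    then F (true :: w u n) else F (false :: w u n))).
    apply: measurable_fun_ifT; [|exact: (ih (fun s => F (true :: s)))
                                |exact: (ih (fun s => F (false :: s)))].
    apply: measurable_fun_ler => //; exact: (ih (fun s => lo p s + p (false :: s))).
  by apply/funext => u /=; case: ifP.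
exists b => // m G Gm; rewrite (Ex_prefix_dep _ mb Gm).
under [in RHS]eq_fun do rewrite (Ex_prefix_dep _ (mc _) Gm).
rewrite (glim_sum HL); last by move=> s; apply: bounded_seqZ; exact: (aM s).
apply: eq_bigr => s _; rewrite (glimZ HL (G (bits_of_word s)) (aM s)); congr (_ * _).
rewrite -/(p s); move: {s}(tval s) => s.
have lo0 : 0 <= lo p s.
  by elim: s => //= e s ih; rewrite addr_ge0//; case: e.
have lo1 : lo p s + p s <= 1.
  elim: s {lo0} => /= [|e s ih]; first by rewrite p1 add0r.
  have := p0 (true :: s); have := p0 (false :: s).
  by move: ih; rewrite (pS s); case: e; lra.
pose A := [set u : measurableTypeR R | w u (size s) == s].
have mA : measurable A.
  have := measurable_bool_set (measurable_prefix_word mb s).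
  by congr measurable; apply/funext => u; rewrite /= bw.
transitivity (Ex unif \1_A).
  apply: Ex_eq => u; rewrite bw indicE; congr (nat_of_bool _)%:R.
  by apply/idP/idP; rewrite inE.
rewrite Ex_indic// (@unif_eq _ _ `[lo p s, lo p s + p s[%classic)//.
  by rewrite unif_itv ?lerDl//= addrAC subrr add0r.
apply/seteqP; split=> u [/= Au]; rewrite !in_itv/= => u01; split=> //.
  by rewrite -(word_of_itv p0 p1 pS s u01).
by rewrite /A/= /w (word_of_itv p0 p1 pS s u01).
Qed.

Section monotone_limit.
Context {dT : measure_display} {T : measurableType dT} {R : realType}.
Variable P : probability T R.

Lemma Ex_ae (f g : T -> R) (N : set T) : measurable N -> P N = 0%E ->
  measurable_fun setT f -> measurable_fun setT g ->
  (forall x, ~ N x -> f x = g x) -> Ex P f = Ex P g.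
Proof.
move=> mN N0 mf mg fg; congr fine; apply: ae_eq_integral => //; try exact/measurable_EFinP.
exists N; split=> // x /=; apply: contra_notP => Nx _.
by rewrite fg.
Qed.

Lemma monotone_L2_limit (r : nat -> T -> R) (K : R) :
  (forall k x, 0 <= r k x) -> (forall k x, r k x <= r k.+1 x) ->
  (forall k, L2 P (r k)) -> (forall k, Ex P (fun x => r k x ^+ 2) <= K) ->
  exists Z : T -> R, exists N : set T,
  [/\ measurable N, P N = 0%E, L2 P Z, (forall x, N x -> Z x = 0) &
      forall x, ~ N x -> (forall k, r k x <= Z x) /\ r k x @[k --> \oo] --> Z x].
Proof.
move=> r0 rS rL rK.
have rM x : {homo r ^~ x : n m / (n <= m)%N >-> n <= m} by apply/nondecreasing_seqP.
pose g k x := (r k x ^+ 2)%:E; pose G x := ereal_sup (range (g ^~ x)).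
have gM x : {homo g ^~ x : n m / (n <= m)%N >-> (n <= m)%E}.
  by move=> n m nm; rewrite lee_fin lerXn2r ?nnegrE//; exact: rM.
have mg k : measurable_fun setT (g k).
  by apply/measurable_EFinP/measurable_funX; exact: L2_measurable (rL k).
have gcvg x : g k x @[k --> \oo] --> G x by exact: ereal_nondecreasing_cvgn.
have rG k x : (g k x <= G x)%E.
  by apply: ereal_sup_ubound; exists k.
have iG : P.-integrable setT G.
  apply/integrableP; split; first exact: (emeasurable_fun_cvg g).
  under eq_integral do rewrite gee0_abs ?(le_trans _ (rG 0%N _))// ?lee_fin ?sqr_ge0//.
  have -> : G = fun x => limn (g ^~ x).
    by apply/funext => x; apply/esym/cvg_lim => //; exact: gcvg.
  rewrite monotone_convergence//.
    apply: (@le_lt_trans _ _ K%:E); last exact: ltry.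
    apply: lime_le; last by apply: nearW => k; rewrite (ExE (rL k).2) lee_fin.
    apply: ereal_nondecreasing_is_cvgn => n m nm; rewrite !(ExE (rL _).2) lee_fin.
    by apply: Ex_le; [exact: (rL n).2|exact: (rL m).2|move=> x; rewrite -lee_fin; exact: gM].
  by move=> n x _; rewrite lee_fin sqr_ge0.
have [N [mN N0 NG]] := integrable_ae measurableT iG.
have Gfin x : ~ N x -> G x \is a fin_num.
  by move=> Nx; apply: contrapT => Gx; apply: Nx; apply: NG => /= /(_ I).
pose Z x := if x \in N then 0 else sup (range (r ^~ x)).
have rub x : ~ N x -> ubound (range (r ^~ x)) (Num.sqrt (fine (G x))).
  move=> Nx _ [k _ <-]; rewrite -(ler_sqr _ _) ?nnegrE ?sqrtr_ge0// sqr_sqrtr.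
    by rewrite -lee_fin fineK ?Gfin//; exact: rG.
  by rewrite fine_ge0// (le_trans _ (rG 0%N x))// lee_fin sqr_ge0.
have Zcvg x : ~ N x -> r k x @[k --> \oo] --> Z x.
  move=> Nx; rewrite /Z memNset//; apply: nondecreasing_cvgn => //.
  by exists (Num.sqrt (fine (G x))); exact: rub.
exists Z, N; split => //.
- have mZ : measurable_fun setT Z.
    apply: (@measurable_fun_cvg _ _ _ _ (fun k x => \1_(~` N) x * r k x)).
      move=> k; apply: measurable_funM; last exact: L2_measurable (rL k).
      by apply: measurable_indic; exact: measurableC.
    move=> x _; rewrite /= indicE in_setC; have [Nx|Nx] := pselect (N x).
      rewrite /Z mem_set//=; under eq_fun do rewrite mul0r; exact: cvg_cst.
    rewrite memNset//=; under eq_fun do rewrite mul1r; exact: Zcvg.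
  split=> //; apply: (le_integrable _ _ _ iG) => //.
    by apply/measurable_EFinP; exact: measurable_funX.
  move=> x _ /=; rewrite ger0_norm ?sqr_ge0//.
  have G0 : (0 <= G x)%E by rewrite (le_trans _ (rG 0%N x))// lee_fin sqr_ge0.
  rewrite gee0_abs//; have [Nx|Nx] := pselect (N x).
    by rewrite /Z mem_set// expr0n.
  rewrite /Z memNset// -(fineK (Gfin _ Nx)) lee_fin -[leRHS]sqr_sqrtr ?fine_ge0//.
  have s0 : range (r ^~ x) !=set0 by exists (r 0%N x), 0%N.
  rewrite lerXn2r ?nnegrE ?sqrtr_ge0//; last exact: ge_sup (rub _ Nx).
  apply: le_trans (r0 0%N x) _; apply: ub_le_sup; last by exists 0%N.
  by exists (Num.sqrt (fine (G x))); exact: rub.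
- by move=> x Nx; rewrite /Z mem_set.
- move=> x Nx; split; last exact: Zcvg.
  move=> k; rewrite -(cvg_lim _ (Zcvg x Nx))//.
  by apply: nondecreasing_cvgn_le => //; apply/cvg_ex; exists (Z x); exact: Zcvg.
Qed.

End monotone_limit.

Section pseudo_lipschitz.
Context {R : realType} {I : finType}.

Definition pseudo_lipschitz (C : R) (F : (I -> R) -> R) :=
  [/\ 0 <= C,
   (forall z z', (forall i, 0 <= z' i <= z i) ->
     `|F z - F z'| <= C * ((1 + \sum_i z i) * \sum_i (z i - z' i))) &
   (forall dT (T : measurableType dT) (z : I -> T -> R),
     (forall i, measurable_fun setT (z i)) ->
     measurable_fun setT (fun x => F (z ^~ x)))].

Context {dT : measure_display} {T : measurableType dT}.
Variable P : probability T R.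
Variables (C : R) (F : (I -> R) -> R).
Hypothesis FC : pseudo_lipschitz C F.
Variable A : I -> T -> R.
Hypothesis A0 : forall i x, 0 <= A i x.
Hypothesis AL : forall i, L2 P (A i).

Let sA_L2 : L2 P (fun x => 1 + \sum_i A i x).
Proof. by apply: L2D; [exact: L2_cst|exact: L2_sum]. Qed.

Let C0 : 0 <= C. Proof. by case: FC. Qed.

Lemma pseudo_lipschitz_growth x (B : I -> R) : (forall i, 0 <= B i <= A i x) ->
  `|F B| <= `|F (fun=> 0)| + C * (1 + \sum_i A i x) ^+ 2.
Proof.
move=> BA; rewrite -[F B](subrK (F (fun=> 0))) addrC (le_trans (ler_normD _ _))// lerD2l.
have [_ FL _] := FC; apply: (le_trans (FL _ _ _)).
  by move=> i; rewrite lexx/=; have /andP[] := BA i.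
apply: ler_wpM2l => //; rewrite expr2.
have SB : \sum_i B i <= \sum_i A i x by apply: ler_sum => i _; have /andP[] := BA i.
have S0 : 0 <= \sum_i B i by apply: sumr_ge0 => i _; have /andP[] := BA i.
under [X in _ * X <= _]eq_bigr do rewrite subr0.
by apply: ler_pM => //; lra.
Qed.

Lemma itg_pseudo_lipschitz (B : I -> T -> R) :
  (forall i, measurable_fun setT (B i)) -> (forall i x, 0 <= B i x <= A i x) ->
  itg P (fun x => F (B ^~ x)).
Proof.
move=> mB BA.
apply: (itg_dom (itgD (itg_cst P `|F (fun=> 0)|) (itgZ C sA_L2.2))).
  by have [_ _] := FC; exact.
by move=> x; apply: pseudo_lipschitz_growth => i; exact: BA.
Qed.

Lemma Ex_pseudo_lipschitz_bound (K : R) :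
  Ex P (fun x => (1 + \sum_i A i x) ^+ 2) <= K ->
  `|Ex P (fun x => F (A ^~ x))| <= `|F (fun=> 0)| + C * K.
Proof.
move=> KA.
have iF : itg P (fun x => F (A ^~ x)).
  by apply: itg_pseudo_lipschitz => [i|i x]; [exact: L2_measurable|rewrite lexx A0].
apply: (le_trans (Ex_norm iF)).
apply: (@le_trans _ _ (`|F (fun=> 0)| + C * Ex P (fun x => (1 + \sum_i A i x) ^+ 2))).
  have iC := itg_cst P `|F (fun=> 0)|; have iS := itgZ C sA_L2.2.
  rewrite -ExZ ?sA_L2.2// -[X in X + _](Ex_cst P) -ExD//; apply: Ex_le.
  - exact: itg_norm.
  - exact: itgD.
  - by move=> x; apply: pseudo_lipschitz_growth => i; rewrite A0 lexx.
by rewrite lerD2l ler_wpM2l.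
Qed.

Lemma Ex_pseudo_lipschitz_dist (B : I -> T -> R) (K e : R) : 0 < e ->
  (forall i, measurable_fun setT (B i)) -> (forall i x, 0 <= B i x <= A i x) ->
  Ex P (fun x => (1 + \sum_i A i x) ^+ 2) <= K ->
  (forall i, Ex P (fun x => (A i x - B i x) ^+ 2) <= e ^+ 2) ->
  `|Ex P (fun x => F (A ^~ x)) - Ex P (fun x => F (B ^~ x))|
    <= C * #|I|%:R * (e * (K + 1)).
Proof.
move=> e0 mB BA KA AB.
have BL i : L2 P (B i).
  apply: (L2_dom (AL i)) => // x; have /andP[B0 BAx] := BA i x.
  by rewrite !ger0_norm// (le_trans B0).
have iA : itg P (fun x => F (A ^~ x)).
  by apply: itg_pseudo_lipschitz => [i|i x]; [exact: L2_measurable|rewrite lexx A0].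
have iB : itg P (fun x => F (B ^~ x)) by exact: itg_pseudo_lipschitz.
rewrite -ExB//; apply: (le_trans (Ex_norm (itgB iA iB))).
pose D i x := (1 + \sum_i A i x) * (A i x - B i x).
have iD i : itg P (D i) by apply: itg_sqrM => //; exact: L2B.
apply: (@le_trans _ _ (C * \sum_i Ex P (D i))).
  rewrite -Ex_sum// -ExZ; last exact: itg_sum.
  apply: Ex_le; first exact/itg_norm/itgB.
    exact/itgZ/itg_sum.
  by move=> x; rewrite /D -mulr_sumr; have [_ FL _] := FC; exact: FL.
rewrite -mulrA ler_wpM2l// mulr_natl -sumr_const; apply: ler_sum => i _.
have := Ex_amgm e0 sA_L2 (L2B (AL i) (BL i)).
rewrite -/(D i) => /(le_trans (ler_norm _))/le_trans; apply.
rewrite mulrDr mulr1 lerD ?ler_wpM2l ?(ltW e0)//.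
by rewrite ler_pdivrMl// -expr2.
Qed.

End pseudo_lipschitz.

Section limit_family.
Context {R : realType} {I : finType} (L : (nat -> R) -> R).
Hypothesis HL : is_generalized_limit L.
Context {dT : measure_display} {T : measurableType dT} (P : probability T R).
Variables (Z : nat -> I -> T -> R) (K : R).
Hypothesis Z0 : forall n i x, 0 <= Z n i x.
Hypothesis ZL : forall n i, L2 P (Z n i).
Hypothesis ZK : forall n, Ex P (fun x => (1 + \sum_i Z n i x) ^+ 2) <= K.
Hypothesis ZU : forall e, 0 < e -> exists k, forall n i,
  Ex P (fun x => (Z n i x - rnd k (Z n i x)) ^+ 2) <= e.

Let code n x j : bool :=
  if unpickle j is Some (k, l, i) then rbit k l (Z n i x) else false.

Let dec (b : nat -> bool) k (i : I) : R :=
  2 ^- k * \sum_(l < 4 ^ k) (b (pickle (k, l : nat, i)))%:R.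

(* The running maximum makes the approximations nondecreasing in [k] for
   every bit sequence, not only for codes of points. *)
Fixpoint decmax (b : nat -> bool) k (i : I) : R :=
  if k is k'.+1 then Num.max (decmax b k' i) (dec b k i) else dec b 0 i.

Let dec_code n x k i : dec (code n x) k i = rnd k (Z n i x).
Proof. by congr (_ * _); apply: eq_bigr => l _; rewrite /code pickleK. Qed.

Let decmax_code n x k i : decmax (code n x) k i = rnd k (Z n i x).
Proof.
by elim: k => [|k ih] /=; rewrite dec_code// ih; apply/max_idPr/rnd_mono.
Qed.

Let dec_ge0 b k i : 0 <= dec b k i.
Proof. by rewrite mulr_ge0 ?invr_ge0 ?exprn_ge0// sumr_ge0. Qed.

Let decmax_ge0 b k i : 0 <= decmax b k i.
Proof. by case: k => [|k] /=; rewrite ?le_max ?dec_ge0 ?orbT. Qed.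

Let decmaxS b k i : decmax b k i <= decmax b k.+1 i.
Proof. by rewrite /= le_max lexx. Qed.

Let decmax_prefix k : exists m, forall b b',
  (forall j, (j < m)%N -> b j = b' j) -> decmax b k = decmax b' k.
Proof.
pose M k := (\max_(li : 'I_(4 ^ k) * I) (pickle (k, li.1 : nat, li.2)).+1)%N.
have decM k' b b' : (forall j, (j < M k')%N -> b j = b' j) ->
    forall i, dec b k' i = dec b' k' i.
  move=> bb' i; congr (_ * _); apply: eq_bigr => l _; rewrite bb'//.
  exact: (leq_bigmax (F := fun li : 'I_(4 ^ k') * I => (pickle (k', li.1 : nat, li.2)).+1) (l, i)).
elim: k => [|k [m ih]].
  by exists (M 0%N) => b b' bb'; apply/funext => i /=; apply: decM.
exists (maxn m (M k.+1)) => b b' bb'; apply/funext => i /=.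
rewrite (ih b b') ?(decM k.+1 b b')// => j jm; apply: bb'.
  by rewrite (leq_trans jm)// leq_maxr.
by rewrite (leq_trans jm)// leq_maxl.
Qed.

Let mcode n j : measurable_fun setT (code n ^~ j).
Proof.
rewrite /code; case: (unpickle j) => [[[k l] i]|]; last exact: measurable_cst.
exact/measurable_rbit/L2_measurable.
Qed.

Lemma limit_family : exists Y : I -> measurableTypeR R -> R,
  [/\ forall i u, 0 <= Y i u, forall i, L2 unif (Y i) &
   forall C F, pseudo_lipschitz C F ->
     Ex unif (fun u => F (Y ^~ u)) = L (fun n => Ex P (fun x => F (Z n ^~ x)))].
Proof.
have [b mb bE] := limit_bits HL P mcode.
pose r i k u := decmax (b u) k i.
have r0 i k u : 0 <= r i k u by exact: decmax_ge0.
have prefix2 k l (G : (I -> R) -> (I -> R) -> R) :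
    exists m, prefix_dep m (fun b => G (decmax b k) (decmax b l)).
  have [[m mk] [m' ml]] := (decmax_prefix k, decmax_prefix l).
  exists (maxn m m') => b1 b2 b12.
  by rewrite (mk b1 b2) ?(ml b1 b2)// => j jm; apply: b12; rewrite leq_max jm ?orbT.
have exE k l (G : (I -> R) -> (I -> R) -> R) :
    Ex unif (fun u => G (fun i => r i k u) (fun i => r i l u)) =
    L (fun n => Ex P (fun x => G (fun i => rnd k (Z n i x)) (fun i => rnd l (Z n i x)))).
  have [m /bE->] := prefix2 k l G.
  congr L; apply/funext => n; apply: Ex_eq => x /=.
  by congr G; apply/funext => i; rewrite decmax_code.
have iG k l (G : (I -> R) -> (I -> R) -> R) :
    itg unif (fun u => G (fun i => r i k u) (fun i => r i l u)).
  have [m mk] := prefix2 k l G.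
  exact: (@itg_prefix_dep _ _ _ unif b mb m (fun b => G (decmax b k) (decmax b l)) mk).
have rL i k : L2 unif (r i k).
  split; last exact: (iG k k (fun z _ => z i ^+ 2)).
  exact: itg_measurable (iG k k (fun z _ => z i)).
have sZL n : L2 P (fun x => 1 + \sum_i Z n i x).
  by apply: L2D; [exact: L2_cst|exact: L2_sum].
have Zsum n i x : Z n i x <= 1 + \sum_i Z n i x.
  rewrite (bigD1 i)//= addrCA lerDl addr_ge0// sumr_ge0// => j _; exact: Z0.
have sqB n i (D : T -> R) : measurable_fun setT D -> (forall x, 0 <= D x <= Z n i x) ->
    0 <= Ex P (fun x => D x ^+ 2) <= K.
  move=> mD DZ; rewrite Ex_sqr_ge0/= (le_trans _ (ZK n))//; apply: Ex_le => //.
  - apply: (proj2 (L2_dom (ZL n i) mD _)) => x; have /andP[D0 DZx] := DZ x.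
    by rewrite (ger0_norm D0) ger0_norm ?Z0.
  - exact: (sZL n).2.
  - move=> x; have /andP[D0 DZx] := DZ x; have DS := le_trans DZx (Zsum n i x).
    by rewrite ler_sqr// nnegrE; exact: le_trans D0 DS.
have glimK (a : nat -> R) e : (forall n, 0 <= a n <= e) -> L a <= e.
  move=> ae; rewrite -(glim_cst HL e); apply: (glim_le HL).
  - by exists e => n; have /andP[? ?] := ae n; rewrite ger0_norm.
  - exact: bounded_seq_cst.
  - by move=> n; have /andP[] := ae n.
have mZ n i : measurable_fun setT (Z n i) by exact: L2_measurable.
have rK i k : Ex unif (fun u => r i k u ^+ 2) <= K.
  rewrite (exE k k (fun z _ => z i ^+ 2)); apply: glimK => n.
  apply: (sqB n i (fun x => rnd k (Z n i x))); first exact: measurable_rnd.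
  by move=> x; rewrite rnd_ge0 rnd_le.
have /choice[YN YNP] i : exists YN : (measurableTypeR R -> R) * set (measurableTypeR R),
    [/\ measurable YN.2, unif YN.2 = 0%E, L2 unif YN.1 & forall u, ~ YN.2 u ->
      (forall k, r i k u <= YN.1 u) /\ r i k u @[k --> \oo] --> YN.1 u].
  have [Y [N [mN N0 YL _ YN]]] :=
    monotone_L2_limit (r0 i) (fun k u => decmaxS (b u) k i) (rL i) (rK i).
  by exists (Y, N).
pose N : set (measurableTypeR R) := \big[setU/set0]_(i : I) (YN i).2.
have [mN N0] : measurable N /\ unif N = 0%E.
  apply: (big_ind (fun A : set (measurableTypeR R) => measurable A /\ unif A = 0%E)).
  - by rewrite measure0.
  - move=> A B [mA A0] [mB B0]; split; first exact: measurableU.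
    by rewrite null_set_setU.
  - by move=> i _; have [] := YNP i.
have NP i u : ~ N u -> ~ (YN i).2 u.
  by apply: contra_not => Nu; rewrite /N (bigD1 i)//=; left.
pose Y i u := \1_(~` N) u * (YN i).1 u; pose r' i k u := \1_(~` N) u * r i k u.
have m1N : measurable_fun setT (\1_(~` N) : measurableTypeR R -> R).
  by apply: measurable_indic; exact: measurableC.
have mr' i k : measurable_fun setT (r' i k).
  by apply: measurable_funM => //; exact: L2_measurable.
have r'P i k u : 0 <= r' i k u <= Y i u.
  rewrite /r' /Y indicE in_setC; have [Nu|Nu] := pselect (N u).
    by rewrite mem_set// !mul0r lexx.
  rewrite memNset//= !mul1r r0/=; have [_ _ _ /(_ u (NP i u Nu))[]] := YNP i.
  exact.
have Y0 i u : 0 <= Y i u by have /andP[] := r'P i 0%N u; exact: le_trans.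
have r'cvg i u : r' i k u @[k --> \oo] --> Y i u.
  rewrite /r' /Y indicE in_setC; have [Nu|Nu] := pselect (N u).
    by rewrite mem_set//= mul0r; under eq_fun do rewrite mul0r; exact: cvg_cst.
  rewrite memNset//= mul1r; under eq_fun do rewrite mul1r.
  by have [_ _ _ /(_ u (NP i u Nu))[]] := YNP i.
have YL i : L2 unif (Y i).
  have [_ _ YL _] := YNP i; apply: (L2_dom YL).
    by apply: measurable_funM => //; exact: L2_measurable YL.
  move=> u; rewrite normrM ler_piMl// indicE ger0_norm//.
  by case: (_ \in _).
have r'E k l (G : (I -> R) -> (I -> R) -> R) :
    measurable_fun setT (fun u => G (fun i => r' i k u) (fun i => r' i l u)) ->
    Ex unif (fun u => G (fun i => r' i k u) (fun i => r' i l u)) =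
    L (fun n => Ex P (fun x => G (fun i => rnd k (Z n i x)) (fun i => rnd l (Z n i x)))).
  move=> mG; rewrite -exE; apply: (Ex_ae mN N0 mG); first exact: itg_measurable (iG k l G).
  move=> u Nu; congr G; apply/funext => i; rewrite /r' indicE in_setC memNset// mul1r.
    by [].
  by [].
have err k e : (forall n i, Ex P (fun x => (Z n i x - rnd k (Z n i x)) ^+ 2) <= e) ->
    forall i, Ex unif (fun u => (Y i u - r' i k u) ^+ 2) <= e.
  move=> Ze i.
  have cv : Ex unif (fun u => (r' i l u - r' i k u) ^+ 2) @[l --> \oo] -->
      Ex unif (fun u => (Y i u - r' i k u) ^+ 2).
    apply: (Ex_dominated_cvg (YL i).2).
    - by move=> l; apply/measurable_funX/measurable_funB.
    - move=> u; apply: (@cvgM R nat); apply: cvgB => //; exact: cvg_cst.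
    - move=> l u; rewrite ger0_norm ?sqr_ge0//.
      by have /andP[? ?] := r'P i l u; have /andP[? ?] := r'P i k u; nra.
  rewrite -(cvg_lim _ cv)//; apply: limr_le.
    by apply/cvg_ex; eexists; exact: cv.
  exists k => // l /= kl.
  rewrite (r'E l k (fun z z' => (z i - z' i) ^+ 2)); last first.
    by apply/measurable_funX/measurable_funB.
  apply: glimK => n; rewrite Ex_sqr_ge0/= (le_trans _ (Ze n i))//.
  apply: Ex_le.
  - by apply: (proj2 (L2B (L2_rnd _ _ _) (L2_rnd _ _ _))).
  - by apply: (proj2 (L2B _ (L2_rnd _ _ _))).
  - move=> x; have := rnd_monoW (Z n i x) kl; have := rnd_le l (Z0 n i x); nra.
exists Y; split=> // C F FC.
have C0 : 0 <= C by case: FC.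
pose K' := Ex unif (fun u => (1 + \sum_i Y i u) ^+ 2).
have K'0 : 0 <= K' by exact: Ex_sqr_ge0.
have K0 : 0 <= K by rewrite (le_trans _ (ZK 0%N))// Ex_sqr_ge0.
have rZ k n i x : 0 <= rnd k (Z n i x) <= Z n i x by rewrite rnd_ge0 rnd_le.
have bZ : bounded_seq (fun n => Ex P (fun x => F (Z n ^~ x))).
  by exists (`|F (fun=> 0)| + C * K) => n; exact: Ex_pseudo_lipschitz_bound.
have brZ k : bounded_seq (fun n => Ex P (fun x => F (fun i => rnd k (Z n i x)))).
  exists (`|F (fun=> 0)| + C * K) => n.
  apply: (@Ex_pseudo_lipschitz_bound _ _ _ _ P C F FC (fun i x => rnd k (Z n i x))).
  - by move=> i x; exact: rnd_ge0.
  - by move=> i; exact: L2_rnd.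
  rewrite (le_trans _ (ZK n))//; apply: Ex_le.
  - by apply: (proj2 (L2D (L2_cst _ _) (L2_sum _ _))) => i; exact: L2_rnd.
  - exact: (sZL n).2.
  - move=> x; rewrite lerXn2r ?nnegrE ?addr_ge0 ?sumr_ge0// => [i _|].
      exact: rnd_ge0.
    by rewrite lerD2l; apply: ler_sum => i _; exact: rnd_le.
have step e : 0 < e -> `|Ex unif (fun u => F (Y ^~ u)) - L (fun n => Ex P (fun x => F (Z n ^~ x)))|
    <= C * #|I|%:R * (e * (K' + 1)) + C * #|I|%:R * (e * (K + 1)).
  move=> e0; have [k Zk] := ZU (exprn_gt0 2 e0).
  have mF : measurable_fun setT (fun u => F (r' ^~ k ^~ u)).
    by have [_ _] := FC; apply.
  rewrite -(subrK (Ex unif (fun u => F (fun i => r' i k u))) (Ex unif _)) -addrA.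
  apply: (le_trans (ler_normD _ _)); apply: lerD.
    by apply: (Ex_pseudo_lipschitz_dist FC) => // i; exact: err.
  rewrite (r'E k k (fun z _ => F z))//; rewrite distrC.
  apply: (glim_dist HL) => // n.
  by apply: (Ex_pseudo_lipschitz_dist FC) => // i; exact: measurable_rnd.
apply/eqP; rewrite -subr_eq0 -normr_le0; apply/ler_addgt0Pl => e e0; rewrite addr0.
pose c := C * #|I|%:R * (K' + 1) + C * #|I|%:R * (K + 1).
have c0 : 0 <= c by rewrite /c addr_ge0 ?mulr_ge0 ?addr_ge0.
have d0 : 0 < e / (c + 1) by rewrite divr_gt0// ltr_wpDl.
apply: (le_trans (step _ d0)).
rewrite !(mulrCA _ (e / (c + 1))) -mulrDr -/c -mulrA ler_piMr ?(ltW e0)//.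
by rewrite ler_pdivrMl ?mulr1 ?ltr_wpDl// lerDl.
Qed.

End limit_family.

Section signed_parts.
Context {R : realType}.
Implicit Types (t : R) (b : bool).

Definition spart b t : R := Num.max (if b then t else - t) 0.

Lemma spart_ge0 b t : 0 <= spart b t.
Proof. by rewrite /spart le_max lexx orbT. Qed.

Lemma spart_le b t : spart b t <= `|t|.
Proof.
rewrite /spart ge_max normr_ge0 andbT.
by case: b; [exact: ler_norm|rewrite -normrN; exact: ler_norm].
Qed.

Lemma spartE t : t = spart true t - spart false t.
Proof. by rewrite /spart /Num.max; case: ltP => ?; case: ltP => ?; lra. Qed.

Lemma measurable_spart dT (T : measurableType dT) b (f : T -> R) :
  measurable_fun setT f -> measurable_fun setT (fun x => spart b (f x)).
Proof.
move=> mf; apply: measurable_maxr => //; case: b => //.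
exact: measurable_funN.
Qed.

Lemma L2_spart dT (T : measurableType dT) (P : probability T R) b (f : T -> R) :
  L2 P f -> L2 P (fun x => spart b (f x)).
Proof.
move=> fL; apply: (L2_dom fL); first exact: measurable_spart (L2_measurable fL).
by move=> x; rewrite (ger0_norm (spart_ge0 _ _)) spart_le.
Qed.

End signed_parts.

Lemma measurable_indic_comp {R : realType} dT (T : measurableType dT)
    dU (U : measurableType dU) (X : T -> U) (B : set U) :
  measurable_fun setT X -> measurable B ->
  measurable_fun setT (fun t => \1_B (X t) : R).
Proof.
move=> mX mB; have mXB : measurable (X @^-1` B).
  by rewrite -[X in measurable X]setTI; exact: mX.
exact: (@measurable_indic _ _ R setT _ mXB).
Qed.

Section martingale.
Context {dT : measure_display} {T : measurableType dT} {R : realType}.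
Variable P : probability T R.

Lemma orthogonal_indic_fun dU (U : measurableType dU) (X : T -> U) (f : T -> R)
    (h : U -> R) :
  measurable_fun setT X -> L2 P f ->
  (forall B, measurable B -> Ex P (fun x => \1_B (X x) * f x) = 0) ->
  measurable_fun setT h -> L2 P (h \o X) -> Ex P (fun x => f x * h (X x)) = 0.
Proof.
move=> mX fL fX mh hL.
have hbL b : L2 P (fun x => spart b (h (X x))) by exact: L2_spart hL.
suff hb b : Ex P (fun x => f x * spart b (h (X x))) = 0.
  under Ex_eq do rewrite [h _]spartE mulrBr.
  by rewrite ExB ?hb ?subrr//; exact: itg_sqrM.
have mf := L2_measurable fL; have fi := L2_itg fL.
have := Ex_rnd_cvg mf (L2_measurable (hbL b)) 
  (fun x => spart_ge0 b (h (X x))) (itg_sqrM fL (hbL b)).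
move=> /cvg_lim <-//; apply: cvg_lim => //.
rewrite (_ : (fun k => _) = cst 0); first exact: cvg_cst.
apply/funext => k.
pose B j : set U := [set u | rbit k j (spart b (h u))].
have mB j : measurable (B j).
  by apply: measurable_bool_set; exact/measurable_rbit/measurable_spart.
have mXB j : measurable (X @^-1` B j) by rewrite -[X in measurable X]setTI; exact: mX.
transitivity (Ex P (fun x => 2 ^- k * \sum_(j < 4 ^ k) \1_(X @^-1` B j) x * f x)).
  apply: Ex_eq => x; rewrite mulrCA mulr_sumr; congr (_ * _); apply: eq_bigr => j _.
  rewrite mulrC indicE; congr (_%:R * _); congr nat_of_bool.
  by apply/idP/idP; rewrite inE.
have iB j : itg P (fun x => \1_(X @^-1` B j) x * f x) by exact: itg_indicM.
rewrite ExZ; last by apply: itg_sum => j; exact: iB.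
by rewrite Ex_sum// big1 ?mulr0// => j _; exact: (fX (B j)).
Qed.

Lemma martingale_sqr_le (x y : T -> R) (B : set R) : L2 P x -> L2 P y ->
  (forall B, measurable B -> Ex P (fun t => \1_B (x t) * (y t - x t)) = 0) ->
  measurable B ->
  Ex P (fun t => \1_B (x t) * x t ^+ 2) <= Ex P (fun t => \1_B (x t) * y t ^+ 2).
Proof.
move=> xL yL xy mB; have mx := L2_measurable xL.
have mxB : measurable (x @^-1` B) by rewrite -[X in measurable X]setTI; exact: mx.
have xBL : L2 P (fun t => \1_B (x t) * x t).
  apply: (L2_dom xL).
    by apply: measurable_funM => //; exact: measurable_indic_comp.
  by move=> t; rewrite normrM ler_piMl// indicE ger0_norm//; case: (_ \in _).
have ix : itg P (fun t => \1_B (x t) * x t ^+ 2).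
  exact: (itg_indicM mxB xL.2).
have iy : itg P (fun t => \1_B (x t) * y t ^+ 2).
  exact: (itg_indicM mxB yL.2).
have := @orthogonal_indic_fun _ R x (fun t => y t - x t) (fun s => \1_B s * s) mx (L2B yL xL) xy.
have mh : measurable_fun setT (fun s : R => \1_B s * s : R).
  by apply: measurable_funM => //; exact: measurable_indic.
move=> /(_ mh xBL) h.
have ixy := itg_sqrM xBL yL.
have e : Ex P (fun t => \1_B (x t) * x t ^+ 2) = Ex P (fun t => \1_B (x t) * x t * y t).
  apply/eqP; rewrite eq_sym -subr_eq0 -ExB// -h; apply/eqP; apply: Ex_eq => t; ring.
have : Ex P (fun t => \1_B (x t) * x t * y t) <=
    Ex P (fun t => 2^-1 * (\1_B (x t) * x t ^+ 2) + 2^-1 * (\1_B (x t) * y t ^+ 2)).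
  apply: Ex_le => //; first by apply: itgD; exact: itgZ.
  by move=> t; rewrite indicE; have := sqr_ge0 (x t - y t); case: (_ \in _) => /=; nra.
rewrite ExD; [|exact: itgZ|exact: itgZ].
rewrite !ExZ// e; lra.
Qed.

Lemma martingale_unif_rnd (y : T -> R) e : L2 P y -> 0 < e ->
  \forall k \near \oo, forall x b, L2 P x ->
  (forall B, measurable B -> Ex P (fun t => \1_B (x t) * (y t - x t)) = 0) ->
  Ex P (fun t => (spart b (x t) - rnd k (spart b (x t))) ^+ 2) <= e.
Proof.
move=> yL e0.
pose y2 t := y t ^+ 2.
have y20 t : 0 <= y2 t by exact: sqr_ge0.
have my2 : measurable_fun setT y2 by apply: measurable_funX; exact: L2_measurable yL.
have iy2 : itg P y2 := yL.2.
have iy2r l : itg P (fun t => rnd l (y2 t)).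
  apply: (itg_dom iy2); first exact: measurable_rnd.
  by move=> t; rewrite ger0_norm ?rnd_ge0 ?rnd_le.
have [l yl] : exists l, Ex P y2 - Ex P (fun t => rnd l (y2 t)) <= e / 2.
  have iy21 : itg P (fun t => 1 * y2 t) by apply: itg_eq iy2 => t; rewrite mul1r.
  have := Ex_rnd_cvg (measurable_cst (1 : R)) my2 y20 iy21.
  under eq_fun do under Ex_eq do rewrite mul1r.
  under Ex_eq do rewrite mul1r.
  have e20 : 0 < e / 2 by rewrite divr_gt0.
  move=> /cvgrPdist_le/(_ _ e20)[l _ /(_ l (leqnn l)) h]; exists l.
  exact: le_trans (ler_norm _) h.
pose c := 1 + 2 ^+ l * Ex P y2.
have c0 : 0 < c by rewrite /c ltr_pwDl// mulr_ge0 ?exprn_ge0// Ex_ge0.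
have : 2^-1 ^+ k @[k --> \oo] --> (0 : R).
  by apply: cvg_expr; rewrite ger0_norm ?invr_ge0// invf_lt1// ltr1n.
have ec0 : 0 < e / 2 / c by rewrite !divr_gt0.
move=> /cvgrPdist_le/(_ _ ec0); apply: filterS => k.
rewrite sub0r normrN ger0_norm ?exprn_ge0 ?invr_ge0// exprVn ler_pdivlMr// => kc x b xL xy.
pose B : set R := [set s | 2 ^+ k < `|s|].
have mB : measurable B.
  by apply: measurable_bool_set; apply: measurable_fun_ltr => //; exact: measurableT_comp.
have xB := martingale_sqr_le xL yL xy mB.
have xT := martingale_sqr_le xL yL xy measurableT.
have mx := L2_measurable xL; have sL := L2_spart b xL.
have mxB : measurable (x @^-1` B) by rewrite -[X in measurable X]setTI; exact: mx.
have i1 : itg P (fun t => \1_B (x t)) by exact: integrable_indic.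
have ix : itg P (fun t => \1_B (x t) * x t ^+ 2) by exact: (itg_indicM mxB xL.2).
have iy : itg P (fun t => \1_B (x t) * y t ^+ 2) by exact: (itg_indicM mxB yL.2).
have k1 : 1 <= 2 ^+ k :> R by rewrite exprn_ege1// ler1n.
have PB : 2 ^+ k * Ex P (fun t => \1_B (x t)) <= Ex P y2.
  apply: (@le_trans _ _ (Ex P (fun t => x t ^+ 2))); last first.
    by move: xT; under Ex_eq do rewrite indicT mul1r; under [leRHS]Ex_eq do rewrite indicT mul1r.
  rewrite -ExZ//; apply: Ex_le => //; [exact: itgZ|exact: xL.2|].
  move=> t; rewrite indicE; have [Bt|] := boolP (x t \in B); last by rewrite mulr0 sqr_ge0.
  move: Bt; rewrite inE mulr1 /B/= -real_normK ?num_real//; nra.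
have yB : Ex P (fun t => \1_B (x t) * y t ^+ 2) <=
    (Ex P y2 - Ex P (fun t => rnd l (y2 t))) + 2 ^+ l * Ex P (fun t => \1_B (x t)).
  rewrite -ExB// -ExZ// -ExD; [|exact: itgB|exact: itgZ].
  apply: Ex_le => //; first by apply: itgD; [exact: itgB|exact: itgZ].
  move=> t; rewrite -/(y2 t); have := rnd_le l (y20 t); have := rnd_le_bound l (y20 t).
  by rewrite indicE; case: (_ \in _) => /=; lra.
have : Ex P (fun t => (spart b (x t) - rnd k (spart b (x t))) ^+ 2) <=
    Ex P (fun t => 2 ^- k + \1_B (x t) * x t ^+ 2).
  apply: Ex_le.
  - apply: (proj2 (L2B sL (L2_rnd _ sL _))) => t; exact: spart_ge0.
  - by apply: itgD => //; exact: itg_cst.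
  - move=> t; apply: (le_trans (rnd_err k (spart_ge0 b (x t)))); rewrite lerD2l.
    have := spart_le b (x t); have := spart_ge0 b (x t).
    case: ifPn => [_ _ _|]; first by rewrite mulr_ge0 ?sqr_ge0// indicE; case: (_ \in _).
    rewrite -ltNge => kx s0 sx; rewrite indicE mem_set ?mul1r.
      by rewrite -[leRHS]real_normK ?num_real// ler_sqr ?nnegrE.
    exact: lt_le_trans kx sx.
rewrite ExD ?Ex_cst//; last exact: itg_cst.
have k0 : 0 < 2 ^- k :> R by rewrite invr_gt0 exprn_gt0.
have PB' : Ex P (fun t => \1_B (x t)) <= 2 ^- k * Ex P y2.
  by rewrite ler_pdivlMl// exprn_gt0.
have : 2 ^+ l * Ex P (fun t => \1_B (x t)) <= 2 ^+ l * (2 ^- k * Ex P y2).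
  by rewrite ler_wpM2l// exprn_ge0.
move: kc; rewrite /c mulrDr mulr1 mulrCA; lra.
Qed.

End martingale.

Section orthants.
Context {R : realType} {d : nat}.

Definition orthant (a : 'I_d -> R) : set (d.-tuple R) :=
  [set x | forall i, a i <= tnth x i].

Definition hat (n : nat) (a : 'I_d -> R) (x : d.-tuple R) : R :=
  Num.max 0 (1 - n%:R * \sum_i Num.max 0 (a i - tnth x i)).

Lemma measurable_hat n a : measurable_fun setT (hat n a).
Proof.
apply: measurable_maxr => //; apply: measurable_funB => //; apply: measurable_funM => //.
apply: measurable_sum => i; apply: measurable_maxr => //; apply: measurable_funB => //.
exact: measurable_tnth.
Qed.

Lemma hat_ge0 n a x : 0 <= hat n a x.
Proof. by rewrite /hat le_max lexx. Qed.

Lemma hat_le1 n a x : hat n a x <= 1.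
Proof.
rewrite /hat ge_max ler01/= gerBl mulr_ge0// sumr_ge0// => i _.
by rewrite le_max lexx.
Qed.

Lemma hat0 a x : hat 0 a x = 1.
Proof. by rewrite /hat mul0r subr0; apply/max_idPr. Qed.

Lemma hat_lip n a x y :
  `|hat n a x - hat n a y| <= n%:R * \sum_i `|tnth x i - tnth y i|.
Proof.
have maxlip (s t : R) : `|Num.max 0 s - Num.max 0 t| <= `|s - t|.
  have := ler_norm (s - t); have := ler_norm (t - s); rewrite [`|t - s|]distrC.
  by rewrite ler_norml /Num.max => h1 h2; case: ltP => ?; case: ltP => ?; apply/andP; split; lra.
apply: (le_trans (maxlip _ _)); set sx := \sum_i _; set sy := \sum_i _.
rewrite (_ : _ - _ = n%:R * (sy - sx)); last by ring.
rewrite normrM normr_nat ler_wpM2l// -sumrB (le_trans (ler_norm_sum _ _ _))//.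
apply: ler_sum => i _; apply: (le_trans (maxlip _ _)).
by rewrite (_ : _ - _ = tnth x i - tnth y i)//; ring.
Qed.

Lemma hat_cvg a x : hat n a x @[n --> \oo] --> (\1_(orthant a) x : R).
Proof.
set s := \sum_i Num.max 0 (a i - tnth x i).
have s0 : 0 <= s by apply: sumr_ge0 => i _; rewrite le_max lexx.
rewrite indicE; have [ax|ax] := pselect (orthant a x).
  rewrite mem_set//; apply: cvg_near_cst; apply: nearW => n; rewrite /hat -/s.
  have -> : s = 0.
    by rewrite /s big1// => i _; apply/max_idPl; rewrite subr_le0.
  by rewrite mulr0 subr0; apply/max_idPr.
rewrite memNset//; have {}s0 : 0 < s.
  rewrite lt_neqAle s0 andbT eq_sym psumr_neq0; last by move=> i _; rewrite le_max lexx.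
  have [i /negP ai] : exists i, ~ (a i <= tnth x i) by apply/existsNP.
  by apply/hasP; exists i; rewrite ?mem_index_enum//= lt_max subr_gt0 [tnth _ _ < _]ltNge ai orbT.
apply: cvg_near_cst; exists (Num.Def.archi_bound s^-1) => // n /= nb.
have s'0 : 0 <= s^-1 by rewrite invr_ge0 ltW.
have : s^-1 < n%:R.
  by rewrite (lt_le_trans (Num.Theory.archi_boundP s'0))// ler_nat.
rewrite -div1r ltr_pdivrMr// => ns; rewrite /hat -/s; apply/max_idPl; lra.
Qed.

Lemma measurable_orthant a : measurable (orthant a).
Proof.
rewrite (_ : orthant a = \bigcap_(i in [set: 'I_d]) [set x | a i <= tnth x i]).
  apply: fin_bigcap_measurable => // i _; apply: measurable_bool_set.
  by apply: measurable_fun_ler => //; exact: measurable_tnth.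
by apply/seteqP; split=> x /= h i; [move=> _|]; exact: h.
Qed.

Lemma orthantI a b :
  orthant a `&` orthant b = orthant (fun i => Num.max (a i) (b i)).
Proof.
apply/seteqP; split=> x /= => [[xa xb] i|h]; first by rewrite ge_max xa xb.
by split=> i; have := h i; rewrite ge_max => /andP[].
Qed.

Lemma measurable_orthantE : @measurable _ (d.-tuple R) = <<s range orthant >>.
Proof.
apply/seteqP; split=> A; last first.
  move: A; apply: smallest_sub; first exact: sigma_algebra_measurable.
  by move=> _ [a _ <-]; exact: measurable_orthant.
move=> mA.
pose f (x : g_sigma_algebraType (range orthant)) : d.-tuple R := x.
suff mf : measurable_fun setT f by have := mf measurableT _ mA; rewrite setTI.
apply/measurable_fun_tnthP => i.
apply: (measurability _ (RGenCInfty.measurableE R)) => //.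
move=> _ [_ [r ->] <-]; rewrite setTI.
rewrite (_ : _ @^-1` _ = \bigcup_n orthant (fun j => if j == i then r else - n%:R)).
  by apply: bigcup_measurable => n _; apply: sub_sigma_algebra; eexists.
apply/seteqP; split=> x /=; rewrite in_itv/= andbT.
  move=> rx; pose c := \sum_j `|tnth x j|.
  have c0 : 0 <= c by exact: sumr_ge0.
  exists (Num.Def.archi_bound c) => // j /=; case: ifPn => [/eqP->//|_].
  rewrite lerNl (le_trans _ (ltW (Num.Theory.archi_boundP c0)))//.
  rewrite (le_trans (ler_norm _))// normrN /c (bigD1 j)//= lerDl; exact: sumr_ge0.
by move=> [n _ /(_ i)]; rewrite eqxx.
Qed.

End orthants.

Section orthant_determined.
Context {R : realType} {d : nat}.
Context {d1 d2 : measure_display} {T1 : measurableType d1} {T2 : measurableType d2}.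
Variables (P1 : probability T1 R) (P2 : probability T2 R).
Variables (X1 : T1 -> d.-tuple R) (X2 : T2 -> d.-tuple R) (f1 : T1 -> R) (f2 : T2 -> R).
Hypotheses (mX1 : measurable_fun setT X1) (mX2 : measurable_fun setT X2).
Hypotheses (i1 : itg P1 f1) (i2 : itg P2 f2).
Hypothesis f12 : forall n a, Ex P1 (fun x => hat n a (X1 x) * f1 x) =
                             Ex P2 (fun x => hat n a (X2 x) * f2 x).

Let Q (B : set (d.-tuple R)) := Ex P1 (fun x => \1_B (X1 x) * f1 x) =
                                Ex P2 (fun x => \1_B (X2 x) * f2 x).

Let Q_cvg (H : nat -> d.-tuple R -> R) (B : set (d.-tuple R)) :
  (forall n, measurable_fun setT (H n)) -> (forall n x, `|H n x| <= 1) ->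
  (forall x, H n x @[n --> \oo] --> (\1_B x : R)) ->
  (forall n, Ex P1 (fun x => H n (X1 x) * f1 x) = Ex P2 (fun x => H n (X2 x) * f2 x)) ->
  Q B.
Proof.
move=> mH H1 HB H12.
have cv dT (T : measurableType dT) (P : probability T R) (X : T -> d.-tuple R) f :
    measurable_fun setT X -> itg P f ->
    Ex P (fun x => H n (X x) * f x) @[n --> \oo] --> Ex P (fun x => \1_B (X x) * f x).
  move=> mX fi; apply: (Ex_dominated_cvg (itg_norm fi)).
  - move=> n; apply: measurable_funM; last exact: itg_measurable fi.
    exact: (measurableT_comp (mH n) mX).
  - by move=> x; apply: cvgMr_tmp; exact: HB.
  - by move=> n x; rewrite normrM ler_piMl.
have := cv _ _ _ _ _ mX1 i1; under eq_fun do rewrite H12.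
by move=> /cvg_unique; apply => //; exact: (cv _ _ _ _ _ mX2 i2).
Qed.

Lemma orthant_determined B : measurable B -> Q B.
Proof.
have QT : Ex P1 f1 = Ex P2 f2.
  have := f12 0 (fun=> 0); under Ex_eq do rewrite hat0 mul1r.
  by under [in RHS]Ex_eq do rewrite hat0 mul1r.
rewrite measurable_orthantE; move: B; apply: (dynkin_induction measurable_orthantE).
- by move=> _ _ [a _ <-] [b _ <-]; rewrite orthantI; eexists.
- rewrite /Q; under Ex_eq do rewrite indicT mul1r.
  by under [in RHS]Ex_eq do rewrite indicT mul1r.
- move=> _ [a _ <-]; apply: (@Q_cvg (hat ^~ a)).
  + by move=> n; exact: measurable_hat.
  + by move=> n x; rewrite ger0_norm ?hat_ge0 ?hat_le1.
  + exact: hat_cvg.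
  + by [].
- move=> B mB QB; rewrite /Q.
  have E dT (T : measurableType dT) (P : probability T R) (X : T -> d.-tuple R) f :
      measurable_fun setT X -> itg P f ->
      Ex P (fun x => \1_(~` B) (X x) * f x) = Ex P f - Ex P (fun x => \1_B (X x) * f x).
    move=> mX fi; rewrite -ExB//.
      by apply: Ex_eq => x; rewrite !indicE in_setC; case: (_ \in _) => /=; lra.
    have mXB : measurable (X @^-1` B) by rewrite -[X in measurable X]setTI; exact: mX.
    exact: (itg_indicM mXB).
  by rewrite !E// QB QT.
- move=> F mF tF QF.
  have Fm x m : F m x -> forall n, \sum_(k < n) \1_(F k) x = (m < n)%N%:R :> R.
    move=> Fmx; elim=> [|n ih]; first by rewrite big_ord0.
    rewrite big_ord_recr/= ih indicE ltnS [in RHS]leq_eqVlt.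
    have [<-|mn] := eqVneq m n; first by rewrite ltnn mem_set ?add0r.
    rewrite memNset ?addr0// => Fnx.
    move/trivIsetP: tF => /(_ m n I I mn); apply/eqP/set0P.
    by exists x.
  have F0 x : ~ (\bigcup_k F k) x -> forall n, \sum_(k < n) \1_(F k) x = 0 :> R.
    by move=> Fx n; rewrite big1// => k _; rewrite indicE memNset// => Fk; apply: Fx; exists k.
  apply: (@Q_cvg (fun n x => \sum_(k < n) \1_(F k) x)).
  + by move=> n; apply: measurable_sum => k; apply: measurable_indic.
  + move=> n x; have [[m _ /Fm ->]|/F0 ->] := pselect ((\bigcup_k F k) x).
      by case: (_ < _)%N; rewrite ?normr1 ?normr0.
    by rewrite normr0.
  + move=> x; rewrite indicE; have [Fx|Fx] := pselect ((\bigcup_k F k) x).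
      rewrite mem_set//; have [m _ Fmx] := Fx; apply: cvg_near_cst.
      by exists m.+1 => // n /= mn; rewrite (Fm _ _ Fmx) mn.
    by rewrite memNset//; apply: cvg_near_cst; apply: nearW => n; rewrite F0.
  + move=> n.
    have E dT (T : measurableType dT) (P : probability T R) (X : T -> d.-tuple R) f :
        measurable_fun setT X -> itg P f ->
        Ex P (fun x => (\sum_(k < n) \1_(F k) (X x)) * f x) =
        \sum_(k < n) Ex P (fun x => \1_(F k) (X x) * f x).
      move=> mX fi; rewrite -Ex_sum; first by apply: Ex_eq => x; rewrite mulr_suml.
      move=> k; have mXF : measurable (X @^-1` (F k)).
        by rewrite -[X in measurable X]setTI; exact: mX.
      exact: (itg_indicM mXF).
    by rewrite !E//; apply: eq_bigr => k _; exact: QF.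
Qed.

End orthant_determined.

Section intermediate_values.
Context {dT : measure_display} {T : measurableType dT} {R : realType}.
Variable P : probability T R.

Definition pr (A : set T) : R := fine (P A).

Lemma prE A : measurable A -> P A = (pr A)%:E.
Proof. by move=> mA; rewrite /pr fineK// fin_num_measure. Qed.

Lemma pr_ge0 A : 0 <= pr A.
Proof. by rewrite fine_ge0// measure_ge0. Qed.

Lemma pr0 : pr set0 = 0. Proof. by rewrite /pr measure0. Qed.

Lemma pr_le A B : measurable A -> measurable B -> A `<=` B -> pr A <= pr B.
Proof.
by move=> mA mB AB; rewrite -lee_fin -!prE// le_measure ?inE.
Qed.

Lemma prU A B : measurable A -> measurable B -> A `&` B = set0 ->
  pr (A `|` B) = pr A + pr B.
Proof.
move=> mA mB AB; apply: EFin_inj.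
by rewrite EFinD -!prE//; [rewrite measureU|exact: measurableU].
Qed.

Lemma prD A B : measurable A -> measurable B -> B `<=` A ->
  pr (A `\` B) = pr A - pr B.
Proof.
move=> mA mB BA; have mD := measurableD mA mB.
apply/eqP; rewrite eq_sym subr_eq addrC -prU//; first by rewrite setDUK.
by rewrite setDIK.
Qed.

Hypothesis P_atomless : forall A, measurable A -> 0 < pr A ->
  exists B, [/\ measurable B, B `<=` A & 0 < pr B < pr A].

Lemma small_subset A e : measurable A -> 0 < pr A -> 0 < e ->
  exists B, [/\ measurable B, B `<=` A & 0 < pr B <= e].
Proof.
move=> mA A0 e0.
have half n : exists B, [/\ measurable B, B `<=` A & 0 < pr B <= 2^-1 ^+ n * pr A].
  elim: n => [|n [B [mB BA /andP[B0 Bn]]]].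
    by exists A; split=> //; rewrite A0 expr0 mul1r lexx.
  have [C [mC CB /andP[C0 CltB]]] := P_atomless mB B0.
  have [CB2|BC2] := leP (pr C) (2^-1 * pr B).
    exists C; split=> //; first exact: subset_trans BA.
    by rewrite C0 (le_trans CB2)// exprS -mulrA ler_wpM2l.
  have mD := measurableD mB mC.
  exists (B `\` C); split=> //; first by apply: subset_trans BA => x [].
  rewrite prD// subr_gt0 CltB/= exprS -mulrA.
  apply: (@le_trans _ _ (2^-1 * pr B)); last by rewrite ler_wpM2l.
  lra.
have : 2^-1 ^+ n * pr A @[n --> \oo] --> 0.
  rewrite -[0](mul0r (pr A)); apply: cvgMr_tmp; apply: cvg_expr.
  by rewrite ger0_norm ?invr_ge0// invf_lt1// ltr1n.
move=> /cvgrPdist_le/(_ _ e0)[n _ /(_ n (leqnn n))].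
rewrite sub0r normrN ger0_norm ?mulr_ge0 ?exprn_ge0 ?invr_ge0 ?pr_ge0// => ne.
have [B [mB BA /andP[B0 Bn]]] := half n.
by exists B; split=> //; rewrite B0 (le_trans Bn).
Qed.

Lemma intermediate_value A t : measurable A -> 0 <= t <= pr A ->
  exists B, [/\ measurable B, B `<=` A & pr B = t].
Proof.
move=> mA /andP[t0 tA].
pose ok S := [/\ measurable S, S `<=` A & pr S <= t].
pose gain S C := [/\ measurable C, C `<=` A `\` S & pr S + pr C <= t].
have step S : exists S', ok S ->
    [/\ ok S', S `<=` S' & forall C, gain S C -> pr C <= 2 * (pr S' - pr S)].
  have [[mS SA St]|nS] := pselect (ok S); last by exists S => /nS.
  pose E := [set pr C | C in gain S].
  have E0 : E 0 by exists set0; rewrite ?pr0//; split=> //; rewrite pr0 addr0.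
  have hE : has_sup E.
    split; first by exists 0.
    exists 1 => _ [C [mC _ _] <-]; rewrite -lee_fin -prE//.
    exact: probability_le1.
  have [s0|s0] := leP (sup E) 0.
    exists S => _; split=> // C gC; rewrite subrr mulr0 (le_trans _ s0)//.
    by apply: ub_le_sup; [case: hE|exists C].
  have [_ [B [mB BS Bt] <-] sB] := @sup_adherent _ E (sup E / 2) (divr_gt0 s0 (ltr0n _ 2)) hE.
  have SB0 : S `&` B = set0.
    by apply/seteqP; split=> x // [Sx /BS[]].
  exists (S `|` B) => _; split.
  - split; [exact: measurableU| |by rewrite prU].
    by move=> x [/SA|/BS[]].
  - by move=> x; left.
  - move=> C gC; rewrite prU// addrAC subrr add0r.
    have : pr C <= sup E by apply: ub_le_sup; [case: hE|exists C].
    lra.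
have [next nextP] := choice step.
pose S n := iter n next set0.
have okS n : ok (S n).
  elim: n => [|n ih] /=; last by have [] := nextP _ ih.
  by split=> //; rewrite pr0.
have SS n : S n `<=` S n.+1 by have [] := nextP _ (okS n).
have mS n : measurable (S n) by have [] := okS n.
pose U := \bigcup_n S n.
have mU : measurable U by exact: bigcupT_measurable.
have UA : U `<=` A by move=> x [n _]; have [_ + _] := okS n; exact.
have SU n : S n `<=` U by move=> x Sx; exists n.
have cS : pr (S n) @[n --> \oo] --> pr U.
  have ndS : nondecreasing_seq S by apply/nondecreasing_seqP => n; apply/subsetPset; exact: SS.
  suff : P (S n) @[n --> \oo] --> (pr U)%:E by move=> /fine_cvg.
  by rewrite -prE//; exact: nondecreasing_cvg_mu.
have Ut : pr U <= t.
  rewrite -(cvg_lim _ cS)//; apply: limr_le; first by apply/cvg_ex; exists (pr U).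
  by apply: nearW => n; have [] := okS n.
exists U; split=> //; apply/eqP; rewrite eq_le Ut/= leNgt; apply/negP => Ult.
have mD := measurableD mA mU.
have D0 : 0 < pr (A `\` U) by rewrite prD// subr_gt0 (lt_le_trans Ult).
have tU0 : 0 < t - pr U by rewrite subr_gt0.
have [C [mC CD /andP[C0 Ct]]] := small_subset mD D0 tU0.
have gC n : pr C <= 2 * (pr (S n.+1) - pr (S n)).
  have [_ _] := nextP _ (okS n); apply; split=> //.
    by move=> x /CD[Ax Ux]; split=> // /SU.
  have := pr_le (mS n) mU (SU n); lra.
have : 2 * (pr (S n.+1) - pr (S n)) @[n --> \oo] --> 2 * (pr U - pr U).
  apply: cvgMl_tmp; apply: cvgB => //.
  by have := cS; rewrite -(cvg_shiftS (fun n => pr (S n))).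
rewrite subrr mulr0 => cv.
have : pr C <= 0.
  rewrite -(cvg_lim _ cv)//; apply: limr_ge; first by apply/cvg_ex; exists 0.
  by apply: nearW => n; exact: gC.
by rewrite leNgt C0.
Qed.

Lemma split_set (K : finType) (a0 : K) (q : K -> R) (s : seq K) :
  (forall a, 0 <= q a) -> uniq s ->
  forall A, measurable A -> \sum_(a <- s) q a = pr A ->
  exists2 l : T -> K, (forall a, measurable (l @^-1` [set a])) &
    forall a, pr (A `&` l @^-1` [set a]) = if a \in s then q a else 0.
Proof.
move=> q0; elim: s => [_|b s ih /= /andP[bs us]] A mA.
  rewrite big_nil => A0; exists (fun=> a0) => a.
    by rewrite preimage_cst; case: ifP.
  rewrite in_nil; apply/eqP; rewrite eq_le pr_ge0 andbT A0 pr_le//.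
  by apply: measurableI => //; rewrite preimage_cst; case: ifP.
rewrite big_cons => qA.
have qs0 : 0 <= \sum_(a <- s) q a by apply: sumr_ge0.
have [B [mB BA Bq]] : exists B, [/\ measurable B, B `<=` A & pr B = q b].
  by apply: intermediate_value => //; rewrite q0 -qA lerDl.
have mD := measurableD mA mB.
have [|l ml lq] := ih us (A `\` B) mD.
  by rewrite prD// -qA Bq addrAC subrr add0r.
pose l' x := if x \in B then b else l x.
have ml'E a : l' @^-1` [set a] = (if a == b then B else set0) `|` (~` B `&` l @^-1` [set a]).
  apply/seteqP; split=> x; rewrite /l'/=.
    have [Bx|Bx] := pselect (B x).
      by rewrite mem_set// => ->; rewrite eqxx; left.
    by rewrite memNset// => <-; right.
  case=> [|[Bx <-]]; last by rewrite memNset.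
  by case: eqP => // -> Bx; rewrite mem_set.
have mif a : measurable (if a == b then B else set0) by case: ifP.
have mr a : measurable (~` B `&` l @^-1` [set a]) by apply: measurableI => //; exact: measurableC.
exists l' => a; first by rewrite ml'E; exact: measurableU.
rewrite ml'E setIUr setIA -setDE prU; last first.
- apply/seteqP; split=> // x [[Ax]].
  by case: ifP => // _ Bx [[_]].
- by apply: measurableI.
- by apply: measurableI.
rewrite lq in_cons; case: eqVneq => [->|ab] /=.
  by rewrite (negbTE bs) addr0 setIidr.
by rewrite setI0 pr0 add0r.
Qed.

Lemma split_cells (K K2 : finType) (a0 : K) (k : T -> K2) (q : K -> K2 -> R) :
  (forall b, measurable (k @^-1` [set b])) -> (forall a b, 0 <= q a b) ->
  (forall b, \sum_a q a b = pr (k @^-1` [set b])) ->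
  exists2 l : T -> K, (forall a, measurable (l @^-1` [set a])) &
    forall a b, pr (l @^-1` [set a] `&` k @^-1` [set b]) = q a b.
Proof.
move=> mk q0 qk.
have /choice[l lP] b : exists l : T -> K, (forall a, measurable (l @^-1` [set a])) /\
    forall a, pr (k @^-1` [set b] `&` l @^-1` [set a]) = q a b.
  have [l ml lq] := split_set a0 (q0 ^~ b) (index_enum_uniq K) (mk b) (qk b).
  by exists l; split=> // a; rewrite lq mem_index_enum.
have lE a b : (fun x => l (k x) x) @^-1` [set a] `&` k @^-1` [set b] =
    k @^-1` [set b] `&` l b @^-1` [set a].
  by apply/seteqP; split=> x /= [] => [<- <-//|-> ?]; split.
exists (fun x => l (k x) x) => a; last first.
  by move=> b; rewrite lE; have [_ ->] := lP b.
rewrite (_ : _ @^-1` _ = \bigcup_(b in [set: K2]) (k @^-1` [set b] `&` l b @^-1` [set a])).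
  apply: fin_bigcup_measurable => // b _; apply: measurableI => //.
  by have [] := lP b.
apply/seteqP; split=> x /=; first by move=> lx; exists (k x).
by move=> [b _ [<-]].
Qed.

End intermediate_values.

Section finite_valued.
Context {dT : measure_display} {T : measurableType dT} {R : realType} {K : finType}.
Variables (P : probability T R) (A : T -> K).
Hypothesis mA : forall a, measurable (A @^-1` [set a]).

Lemma finite_valuedE (G : K -> R) x : G (A x) = \sum_a G a * \1_(A @^-1` [set a]) x.
Proof.
rewrite (bigD1 (A x))//= indicE mem_set// mulr1 big1 ?addr0// => a aA.
by rewrite indicE memNset ?mulr0// => /= Aa; rewrite Aa eqxx in aA.
Qed.

Lemma measurable_finite_valued (G : K -> R) : measurable_fun setT (G \o A).
Proof.
rewrite (_ : G \o A = fun x => \sum_a G a * \1_(A @^-1` [set a]) x).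
  by apply: measurable_sum => a; apply: measurable_funM => //; exact: measurable_indic.
by apply/funext => x /=; exact: finite_valuedE.
Qed.

Lemma L2_finite_valued (G : K -> R) : L2 P (G \o A).
Proof.
apply: (@L2_bounded _ _ _ _ _ (\sum_a `|G a|)); first exact: measurable_finite_valued.
by move=> x /=; rewrite (bigD1 (A x))//= lerDl sumr_ge0.
Qed.

Lemma Ex_finite_valuedM (G : K -> R) f : itg P f ->
  Ex P (fun x => f x * G (A x)) =
  \sum_a G a * Ex P (fun x => \1_(A @^-1` [set a]) x * f x).
Proof.
move=> fi; have iA a := itg_indicM (mA a) fi.
under eq_bigr do rewrite -ExZ//.
rewrite -Ex_sum; last by move=> a; exact: itgZ.
apply: Ex_eq => x; rewrite finite_valuedE mulr_sumr; apply: eq_bigr => a _.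
by rewrite mulrCA [f x * _]mulrC.
Qed.

Lemma Ex_finite_valued (G : K -> R) :
  Ex P (G \o A) = \sum_a G a * pr P (A @^-1` [set a]).
Proof.
have := Ex_finite_valuedM G (itg_cst P 1).
under Ex_eq do rewrite mul1r.
move=> ->; apply: eq_bigr => a _; congr (_ * _).
by under Ex_eq do rewrite mulr1; rewrite Ex_indic.
Qed.

End finite_valued.

Section finite_conditioning.
Context {dT : measure_display} {T : measurableType dT} {R : realType} {K : finType}.
Variables (P : probability T R) (A : T -> K).
Hypothesis mA : forall a, measurable (A @^-1` [set a]).

(* When the cell is negligible the division by zero returns 0. *)
Definition cell_mean (f : T -> R) (a : K) : R :=
  Ex P (fun x => \1_(A @^-1` [set a]) x * f x) / pr P (A @^-1` [set a]).

Lemma cell_mean_orthogonal (f : T -> R) (h : K -> R) : L2 P f ->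
  Ex P (fun x => (f x - cell_mean f (A x)) * h (A x)) = 0.
Proof.
move=> fL; have fi := L2_itg fL.
have mL := L2_finite_valued P mA (cell_mean f).
have hL := L2_finite_valued P mA h.
transitivity (Ex P (fun x => f x * h (A x)) - Ex P (fun x => 1 * (cell_mean f (A x) * h (A x)))).
  rewrite -ExB; first by apply: Ex_eq => x; rewrite mul1r mulrBl.
    exact: (itg_sqrM fL hL).
  by apply: itg_eq (itg_sqrM mL hL) => x; rewrite mul1r.
rewrite (Ex_finite_valuedM mA h fi).
rewrite (Ex_finite_valuedM mA (fun a => cell_mean f a * h a) (itg_cst P 1)) -sumrB.
rewrite big1// => a _; under [X in _ - _ * X]Ex_eq do rewrite mulr1.
rewrite Ex_indic// -/(pr P _).
suff me : cell_mean f a * pr P (A @^-1` [set a]) = Ex P (fun x => \1_(A @^-1` [set a]) x * f x).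
  by rewrite mulrAC me mulrC subrr.
rewrite /cell_mean; have [p0|p0] := eqVneq (pr P (A @^-1` [set a])) 0; last by rewrite divfK.
rewrite p0 mulr0 -[LHS](Ex_cst P); apply: (Ex_ae (mA a)).
- by rewrite prE// p0.
- exact: measurable_cst.
- exact: itg_measurable (itg_indicM (mA a) fi).
- by move=> x Ax; rewrite indicE memNset// mul0r.
Qed.

End finite_conditioning.

Section scalar_rounding.
Context {R : realType}.

Definition srnd k (t : R) : R := rnd k (spart true t) - rnd k (spart false t).

Lemma srnd_le k t : `|srnd k t| <= 2 * `|t|.
Proof.
rewrite (le_trans (ler_normB _ _))// mulr_natl mulr2n lerD//.
  by rewrite ger0_norm ?rnd_ge0// (le_trans (rnd_le _ (spart_ge0 _ _)))// spart_le.
by rewrite ger0_norm ?rnd_ge0// (le_trans (rnd_le _ (spart_ge0 _ _)))// spart_le.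
Qed.

Context {dT : measure_display} {T : measurableType dT} (P : probability T R).

Lemma L2_srnd k f : L2 P f -> L2 P (fun x => srnd k (f x)).
Proof.
move=> fL; apply: L2B; apply: L2_rnd; try exact: L2_spart.
  by move=> x; exact: spart_ge0.
by move=> x; exact: spart_ge0.
Qed.

Lemma Ex_srnd_sqr_le k f : L2 P f ->
  Ex P (fun x => srnd k (f x) ^+ 2) <= 4 * Ex P (fun x => f x ^+ 2).
Proof.
move=> fL; rewrite -ExZ; last exact: fL.2.
apply: Ex_le; [exact: (L2_srnd k fL).2|exact: itgZ fL.2|].
move=> x; have := srnd_le k (f x).
rewrite -[_ ^+ 2]real_normK ?num_real// -[f x ^+ 2]real_normK ?num_real//.
have := normr_ge0 (srnd k (f x)); have := normr_ge0 (f x); nra.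
Qed.

Lemma Ex_srnd_err f e : L2 P f -> 0 < e ->
  \forall k \near \oo, Ex P (fun x => (f x - srnd k (f x)) ^+ 2) <= e.
Proof.
move=> fL e0; have sL b := L2_spart b fL.
have s0 b x := spart_ge0 b (f x).
have e4 : 0 < e / 4 by rewrite divr_gt0.
have ct := Ex_rnd_sqr_cvg (sL true) (s0 true).
have cf := Ex_rnd_sqr_cvg (sL false) (s0 false).
move/cvgrPdist_le: ct => /(_ _ e4); move/cvgrPdist_le: cf => /(_ _ e4).
apply: filterS2 => k; rewrite !sub0r !normrN.
move=> /(le_trans (ler_norm _)) hf /(le_trans (ler_norm _)) ht.
have dL b := L2B (sL b) (L2_rnd k (sL b) (s0 b)).
apply: (@le_trans _ _ (2 * Ex P (fun x => (spart true (f x) - rnd k (spart true (f x))) ^+ 2) +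
   2 * Ex P (fun x => (spart false (f x) - rnd k (spart false (f x))) ^+ 2))); last by lra.
have i b := itgZ 2 (dL b).2.
rewrite -!ExZ; [|exact: (dL _).2|exact: (dL _).2]; rewrite -ExD//; apply: Ex_le.
- exact: (L2B fL (L2_srnd k fL)).2.
- exact: itgD.
- move=> x; rewrite {1}[f x]spartE /srnd.
  have := sqr_ge0 ((spart true (f x) - rnd k (spart true (f x))) +
                   (spart false (f x) - rnd k (spart false (f x)))).
  nra.
Qed.

End scalar_rounding.

Section cells.
Context {R : realType} {d : nat}.

Definition cell k := {ffun 'I_d * bool * 'I_(4 ^ k) -> bool}.

Definition cell_of k (x : d.-tuple R) : cell k :=
  [ffun p : 'I_d * bool * 'I_(4 ^ k) => rbit k p.2 (spart p.1.2 (tnth x p.1.1))].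

Definition cell_pt k (a : cell k) (i : 'I_d) : R :=
  2 ^- k * \sum_(j < 4 ^ k) (a (i, true, j))%:R -
  2 ^- k * \sum_(j < 4 ^ k) (a (i, false, j))%:R.

Lemma cell_ptE k x i : cell_pt (cell_of k x) i = srnd k (tnth x i).
Proof.
by congr (_ * _ - _ * _); apply: eq_bigr => j _; rewrite ffunE.
Qed.

Lemma measurable_cell_of k a : measurable (@cell_of k @^-1` [set a]).
Proof.
rewrite (_ : _ @^-1` _ = \bigcap_(p in [set: 'I_d * bool * 'I_(4 ^ k)])
  [set x : d.-tuple R | rbit k p.2 (spart p.1.2 (tnth x p.1.1)) == a p]).
  apply: fin_bigcap_measurable => // p _; apply: measurable_bool_set.
  have mr : measurable_fun setT (fun x : d.-tuple R => rbit k p.2 (spart p.1.2 (tnth x p.1.1))).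
    by apply/measurable_rbit/measurable_spart; exact: measurable_tnth.
  case: (a p); first by under eq_fun do rewrite eqb_id.
  by under eq_fun do rewrite eqbF_neg; exact: measurable_neg.
apply/seteqP; split=> x /=; first by move=> <- p _ /=; rewrite ffunE.
by move=> h; apply/ffunP => p; rewrite ffunE; exact/eqP/h.
Qed.

End cells.

(* [coord] of mathcomp's vector.v would shadow the one of Defs.v. *)
Local Notation coord := Pilot.Defs.coord.

Section random_vectors.
Context {dT : measure_display} {T : measurableType dT} {R : realType} {d : nat}.
Variable P : probability T R.
Implicit Types X Y : T -> d.-tuple R.

Lemma measurable_coord X i : measurable_fun setT X ->
  measurable_fun setT (fun w => coord (X w) i).
Proof. by move=> /measurable_fun_tnthP/(_ i). Qed.

Lemma itg_ge0 (f : T -> R) : measurable_fun setT f -> (forall x, 0 <= f x) ->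
  (\int[P]_x (f x)%:E < +oo)%E -> itg P f.
Proof.
move=> mf f0 fy; apply/integrableP; split; first exact/measurable_EFinP.
by under eq_integral do rewrite /= ger0_norm//.
Qed.

Lemma L2vec_coordP X : measurable_fun setT X ->
  (\int[P]_w (sqnorm (X w))%:E < +oo)%E <-> forall i, L2 P (fun w => coord (X w) i).
Proof.
move=> mX; split=> [Xy i|XL].
  have mXi := measurable_coord _ mX.
  have sX : itg P (fun w => sqnorm (X w)).
    apply: itg_ge0 => //; last by move=> w; apply: sumr_ge0 => j _; exact: sqr_ge0.
    by apply: measurable_sum => j; exact: measurable_funX.
  split=> //; apply: (itg_dom sX); first exact: measurable_funX.
  move=> w; rewrite ger0_norm ?sqr_ge0// /sqnorm (bigD1 i)//= lerDl.
  by apply: sumr_ge0 => j _; exact: sqr_ge0.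
have sX : itg P (fun w => sqnorm (X w)).
  by apply: itg_sum => i; exact: (XL i).2.
by rewrite ExE// ltry.
Qed.

Lemma integral_setE (A : set T) (f : T -> R) : measurable A -> itg P f ->
  (\int[P]_(x in A) (f x)%:E = (Ex P (fun x => \1_A x * f x))%:E)%E.
Proof.
move=> mA fi; rewrite -Ex_setI /Rintegral fineK//; apply: integrable_fin_num => //.
exact: (integrableS measurableT).
Qed.

Definition martingale_pair X Y := forall (B : set (d.-tuple R)) i, measurable B ->
  Ex P (fun w => \1_B (X w) * (coord (Y w) i - coord (X w) i)) = 0.

Lemma martingale_pairP X Y : measurable_fun setT X ->
  (forall i, L2 P (fun w => coord (X w) i)) ->
  (forall i, L2 P (fun w => coord (Y w) i)) ->
  (forall (B : set (d.-tuple R)) i, measurable B ->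
    (\int[P]_(w in X @^-1` B) (coord (Y w) i)%:E =
     \int[P]_(w in X @^-1` B) (coord (X w) i)%:E)%E) <-> martingale_pair X Y.
Proof.
move=> mX XL YL.
have E B i : measurable B ->
    Ex P (fun w => \1_B (X w) * (coord (Y w) i - coord (X w) i)) =
    Ex P (fun w => \1_(X @^-1` B) w * coord (Y w) i) -
    Ex P (fun w => \1_(X @^-1` B) w * coord (X w) i).
  move=> mB; have mXB : measurable (X @^-1` B) by rewrite -[X in measurable X]setTI; exact: mX.
  rewrite -ExB; first by apply: Ex_eq => w; rewrite mulrBr.
    by apply: itg_indicM => //; exact: L2_itg.
  by apply: itg_indicM => //; exact: L2_itg.
split=> h B i mB; have mXB : measurable (X @^-1` B) by rewrite -[X in measurable X]setTI; exact: mX.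
  have := h B i mB; rewrite !integral_setE//; try exact: L2_itg.
  by move=> [e]; rewrite E// e subrr.
rewrite !integral_setE//; try exact: L2_itg.
by congr EFin; apply/eqP; rewrite -subr_eq0 -E// h.
Qed.

Lemma Ex_Sform (S : 'M[R]_d) X Y :
  (forall i, L2 P (fun w => coord (X w) i)) ->
  (forall i, L2 P (fun w => coord (Y w) i)) ->
  itg P (fun w => Sform S (X w) (Y w)) /\
  Ex P (fun w => Sform S (X w) (Y w)) =
    \sum_i \sum_j S i j * Ex P (fun w => coord (X w) i * coord (Y w) j).
Proof.
move=> XL YL; have iXY i j := itg_sqrM (XL i) (YL j).
have e w : Sform S (X w) (Y w) = \sum_i \sum_j S i j * (coord (X w) i * coord (Y w) j).
  apply: eq_bigr => i _; rewrite mulr_sumr; apply: eq_bigr => j _.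
  by rewrite mulrCA.
have iS i j := itgZ (S i j) (iXY i j).
have iSS i := itg_sum (index_enum 'I_d) (iS i).
split; first by apply: itg_eq (itg_sum (index_enum 'I_d) iSS) => w; rewrite e.
under Ex_eq do rewrite e.
rewrite Ex_sum; last by move=> i; exact: itg_sum.
apply: eq_bigr => i _; rewrite Ex_sum//; apply: eq_bigr => j _.
by rewrite ExZ.
Qed.

End random_vectors.

Section density.
Context {R : realType} {d : nat}.
Context {dT dO : measure_display} {T : measurableType dT} {Omega : measurableType dO}.
Variables (mu : probability T R) (P : probability Omega R).
Variables (X' Y' : T -> d.-tuple R) (Y : Omega -> d.-tuple R).
Hypotheses (mX' : measurable_fun setT X') (mY' : measurable_fun setT Y')
  (mY : measurable_fun setT Y).
Hypothesis X'L : forall i, L2 mu (fun w => coord (X' w) i).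
Hypothesis Y'L : forall i, L2 mu (fun w => coord (Y' w) i).
Hypothesis YL : forall i, L2 P (fun w => coord (Y w) i).
Hypothesis same_law : forall B, measurable B -> mu (Y' @^-1` B) = P (Y @^-1` B).
Hypothesis mart : martingale_pair mu X' Y'.
Hypothesis Y_atomless : atomless (law P Y).

Let preim dU (U : measurableType dU) (X : U -> d.-tuple R) (B : set (d.-tuple R)) :
  measurable_fun setT X -> measurable B -> measurable (X @^-1` B).
Proof. by move=> mX mB; rewrite -[X in measurable X]setTI; exact: mX. Qed.

Lemma label_exists k : exists2 l : d.-tuple R -> @cell d k,
  (forall a, measurable (l @^-1` [set a])) &
  forall G : @cell d k -> @cell d k -> R,
    Ex P (fun w => G (l (Y w)) (cell_of k (Y w))) =
    Ex mu (fun t => G (cell_of k (X' t)) (cell_of k (Y' t))).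
Proof.
pose Yf : {mfun Omega >-> d.-tuple R} :=
  MeasurableFun.Pack (MeasurableFun.Class (isMeasurableFun.Build _ _ _ _ _ mY)).
pose nu : probability (d.-tuple R) R := distribution P Yf.
have nuE A : pr nu A = pr P (Y @^-1` A) by [].
pose q a b := pr mu (X' @^-1` (@cell_of R d k @^-1` [set a]) `&`
                     Y' @^-1` (@cell_of R d k @^-1` [set b])).
have mc := @measurable_cell_of R d k.
have pairE dU (U : measurableType dU) (Q : probability U R) (A B : U -> @cell d k)
    (G : @cell d k -> @cell d k -> R) :
    (forall a, measurable (A @^-1` [set a])) -> (forall a, measurable (B @^-1` [set a])) ->
    Ex Q (fun u => G (A u) (B u)) =
    \sum_a \sum_b G a b * pr Q (A @^-1` [set a] `&` B @^-1` [set b]).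
  move=> mA mB; have pre a b : (fun u => (A u, B u)) @^-1` [set (a, b)] =
      A @^-1` [set a] `&` B @^-1` [set b].
    by apply/seteqP; split=> u /= => [[-> ->]|[-> ->]].
  have mAB ab : measurable ((fun u => (A u, B u)) @^-1` [set ab]).
    by case: ab => a b; rewrite pre; exact: measurableI.
  rewrite pair_bigA/=; have := Ex_finite_valued Q mAB (fun ab => G ab.1 ab.2).
  by move=> /= ->; apply: eq_bigr => -[a b] _ /=; rewrite pre.
have mX'c a := preim mX' (mc a); have mY'c a := preim mY' (mc a).
have nuA A : measurable A -> 0 < pr nu A ->
    exists B, [/\ measurable B, B `<=` A & 0 < pr nu B < pr nu A].
  move=> mA; rewrite -lte_fin -prE// => A0.
  have [B [mB BA] [B0 BltA]] := Y_atomless mA A0.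
  by exists B; split=> //; rewrite -!lte_fin -!prE// B0.
have q0 a b : 0 <= q a b by exact: pr_ge0.
have qk b : \sum_a q a b = pr nu (cell_of k @^-1` [set b]).
  rewrite nuE /pr -same_law// -Ex_indic//.
  have := pairE _ _ mu (cell_of k \o X') (cell_of k \o Y') (fun _ b' => (b' == b)%:R) mX'c mY'c.
  rewrite [LHS](_ : _ = Ex mu \1_(Y' @^-1` (cell_of k @^-1` [set b]))); last first.
    apply: Ex_eq => t; rewrite indicE; congr (nat_of_bool _)%:R.
    by apply/eqP/idP; rewrite inE.
  move=> ->; apply: eq_bigr => a _; rewrite (bigD1 b)//= eqxx mul1r big1 ?addr0//.
  by move=> b' /negbTE ->; rewrite mul0r.
have [l ml lq] := split_cells nuA ([ffun=> false] : @cell d k) mc q0 qk.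
exists l => // G.
rewrite (pairE _ _ P (l \o Y) (cell_of k \o Y) G
  (fun a => preim mY (ml a)) (fun a => preim mY (mc a))).
rewrite (pairE _ _ mu (cell_of k \o X') (cell_of k \o Y') G mX'c mY'c).
by apply: eq_bigr => a _; apply: eq_bigr => b _; rewrite -[in RHS]/(q a b) -lq.
Qed.

Lemma density_step k (e M : R) : 0 < e ->
  (forall i, Ex P (fun w => coord (Y w) i ^+ 2) <= M) ->
  (forall i, Ex mu (fun t => coord (X' t) i ^+ 2) <= M) ->
  (forall i, Ex mu (fun t => coord (Y' t) i ^+ 2) <= M) ->
  (forall i, Ex P (fun w => (coord (Y w) i - srnd k (coord (Y w) i)) ^+ 2) <= e ^+ 2) ->
  (forall i, Ex mu (fun t => (coord (X' t) i - srnd k (coord (X' t) i)) ^+ 2) <= e ^+ 2) ->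
  (forall i, Ex mu (fun t => (coord (Y' t) i - srnd k (coord (Y' t) i)) ^+ 2) <= e ^+ 2) ->
  exists2 X, Xset P Y X & forall i j,
    `|Ex P (fun w => coord (X w) i * coord (Y w) j) -
      Ex mu (fun t => coord (X' t) i * coord (Y' t) j)| <= e * (10 * M + 144).
Proof.
move=> e0 YM X'M Y'M Ye X'e Y'e; have [l ml lG] := label_exists k.
have mlY a : measurable ((l \o Y) @^-1` [set a]) by exact: (preim mY (ml a)).
pose v i a := cell_mean P (l \o Y) (fun w => coord (Y w) i) a.
pose x y : d.-tuple R := [tuple v i (l y) | i < d].
pose X w := x (Y w).
have coordX w i : coord (X w) i = v i (l (Y w)) by rewrite /coord tnth_mktuple.
have mx : measurable_fun setT x.
  apply/measurable_fun_tnthP => i; rewrite (_ : _ \o _ = v i \o l).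
    exact: measurable_finite_valued.
  by apply/funext => y /=; rewrite tnth_mktuple.
have mX : measurable_fun setT X by exact: measurableT_comp.
have XL i : L2 P (fun w => coord (X w) i).
  by apply: L2_eq (L2_finite_valued P mlY (v i)) => w; rewrite coordX.
have ort i h : Ex P (fun w => (coord (Y w) i - coord (X w) i) * h (l (Y w))) = 0.
  rewrite -(cell_mean_orthogonal mlY h (YL i)); apply: Ex_eq => w.
  by rewrite coordX.
exists X.
  split; first by split=> //; apply/L2vec_coordP.
  split.
    by move=> B mB; exists (x @^-1` B); rewrite ?setTI// -[X in measurable X]setTI; exact: mx.
  apply/martingale_pairP => // B i mB.
  rewrite -(ort i (fun a => \1_B [tuple v i a | i < d])); apply: Ex_eq => w.
  by rewrite mulrC.
pose c i (a : @cell d k) : R := cell_pt a i.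
pose W i w := c i (l (Y w)).
have WL i : L2 P (W i) by exact: (L2_finite_valued P mlY (c i)).
have cE i y : c i (cell_of k y) = srnd k (coord y i) by rewrite /c cell_ptE.
have sYL i := L2_srnd k (YL i); have sX'L i := L2_srnd k (X'L i); have sY'L i := L2_srnd k (Y'L i).
have dY i := L2B (YL i) (sYL i); have dX' i := L2B (X'L i) (sX'L i).
have dY' i := L2B (Y'L i) (sY'L i).
have HW i : Ex P (fun w => (coord (X w) i - W i w) ^+ 2) <= 36 * e ^+ 2.
  pose h a := v i a - c i a.
  have hL : L2 P (fun w => h (l (Y w))) by exact: (L2_finite_valued P mlY h).
  have mlX' a : measurable ((cell_of k \o X') @^-1` [set a]).
    exact: (preim mX' (measurable_cell_of a)).
  have h'L : L2 mu (fun t => h (cell_of k (X' t))) by exact: (L2_finite_valued mu mlX' h).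
  have e1 : Ex P (fun w => (coord (X w) i - W i w) ^+ 2) =
      Ex P (fun w => (coord (Y w) i - srnd k (coord (Y w) i)) * h (l (Y w))) +
      Ex P (fun w => (srnd k (coord (Y w) i) - W i w) * h (l (Y w))) -
      Ex P (fun w => (coord (Y w) i - coord (X w) i) * h (l (Y w))).
    have i1 := itg_sqrM (dY i) hL; have i2 := itg_sqrM (L2B (sYL i) (WL i)) hL.
    have i3 := itg_sqrM (L2B (YL i) (XL i)) hL.
    rewrite -ExD// -ExB//; last exact: itgD.
    apply: Ex_eq => w; rewrite /h -coordX -/(W i w); ring.
  have e2 : Ex P (fun w => (srnd k (coord (Y w) i) - W i w) * h (l (Y w))) =
      Ex mu (fun t => (coord (X' t) i - srnd k (coord (X' t) i)) * h (cell_of k (X' t))) -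
      Ex mu (fun t => (coord (Y' t) i - srnd k (coord (Y' t) i)) * h (cell_of k (X' t))) +
      Ex mu (fun t => (coord (Y' t) i - coord (X' t) i) * h (cell_of k (X' t))).
    transitivity (Ex mu (fun t =>
        (srnd k (coord (Y' t) i) - srnd k (coord (X' t) i)) * h (cell_of k (X' t)))).
      have := lG (fun a b => (c i b - c i a) * h a).
      under Ex_eq do rewrite cE.
      by move=> ->; apply: Ex_eq => t; rewrite !cE.
    have i1 := itg_sqrM (dX' i) h'L; have i2 := itg_sqrM (dY' i) h'L.
    have i3 := itg_sqrM (L2B (Y'L i) (X'L i)) h'L.
    rewrite -ExB// -ExD//; last exact: itgB.
    by apply: Ex_eq => t; ring.
  have e3 : Ex mu (fun t => (coord (Y' t) i - coord (X' t) i) * h (cell_of k (X' t))) = 0.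
    have mh := measurable_finite_valued (@measurable_cell_of R d k) h.
    apply: (orthogonal_indic_fun mX' (L2B (Y'L i) (X'L i)) _ mh h'L).
    by move=> B mB; exact: mart.
  have h2 : Ex mu (fun t => h (cell_of k (X' t)) ^+ 2) =
      Ex P (fun w => (coord (X w) i - W i w) ^+ 2).
    rewrite -(lG (fun a _ => h a ^+ 2)); apply: Ex_eq => w.
    by rewrite coordX.
  have h2' : Ex P (fun w => h (l (Y w)) ^+ 2) = Ex P (fun w => (coord (X w) i - W i w) ^+ 2).
    by apply: Ex_eq => w; rewrite coordX.
  rewrite ort subr0 e2 e3 addr0 in e1.
  have six : 0 < 6 :> R by [].
  have := Ex_amgm six (dY i) hL; have := Ex_amgm six (dX' i) h'L; have := Ex_amgm six (dY' i) h'L.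
  rewrite h2 h2' !ler_norml => /andP[a1 _] /andP[_ a2] /andP[_ a3].
  have := Ye i; have := X'e i; have := Y'e i; lra.
move=> i j.
have HWi := HW i.
have W2 : Ex P (fun w => W i w ^+ 2) <= 4 * M.
  rewrite (lG (fun a _ => c i a ^+ 2)); under Ex_eq do rewrite cE.
  by rewrite (le_trans (Ex_srnd_sqr_le k (X'L i)))// ler_pM2l.
have X'2 : Ex mu (fun t => srnd k (coord (X' t) i) ^+ 2) <= 4 * M.
  by rewrite (le_trans (Ex_srnd_sqr_le k (X'L i)))// ler_pM2l.
have WY : Ex P (fun w => W i w * srnd k (coord (Y w) j)) =
    Ex mu (fun t => srnd k (coord (X' t) i) * srnd k (coord (Y' t) j)).
  have := lG (fun a b => c i a * c j b).
  under Ex_eq do rewrite cE.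
  by move=> ->; apply: Ex_eq => t; rewrite !cE.
have dW := L2B (XL i) (WL i).
have -> : Ex P (fun w => coord (X w) i * coord (Y w) j) =
    Ex P (fun w => coord (Y w) j * (coord (X w) i - W i w)) +
    Ex P (fun w => W i w * (coord (Y w) j - srnd k (coord (Y w) j))) +
    Ex P (fun w => W i w * srnd k (coord (Y w) j)).
  have i1 := itg_sqrM (YL j) dW; have i2 := itg_sqrM (WL i) (dY j).
  have i3 := itg_sqrM (WL i) (sYL j).
  rewrite -ExD// -ExD//; last exact: itgD.
  by apply: Ex_eq => w; ring.
have -> : Ex mu (fun t => coord (X' t) i * coord (Y' t) j) =
    Ex mu (fun t => coord (Y' t) j * (coord (X' t) i - srnd k (coord (X' t) i))) +
    Ex mu (fun t => srnd k (coord (X' t) i) * (coord (Y' t) j - srnd k (coord (Y' t) j))) +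
    Ex mu (fun t => srnd k (coord (X' t) i) * srnd k (coord (Y' t) j)).
  have i1 := itg_sqrM (Y'L j) (dX' i); have i2 := itg_sqrM (sX'L i) (dY' j).
  have i3 := itg_sqrM (sX'L i) (sY'L j).
  rewrite -ExD// -ExD//; last exact: itgD.
  by apply: Ex_eq => t; ring.
rewrite WY.
have e2 : e ^+ 2 <= 36 * e ^+ 2 by have := exprn_gt0 2 e0; lra.
have eM (E0 E1 A : R) (r : R) : `|E0| <= e * E1 + e^-1 * A -> E1 <= r -> A <= 36 * e ^+ 2 ->
    `|E0| <= e * (r + 36).
  move=> h1 h2 h3; apply: (le_trans h1); rewrite mulrDr lerD ?ler_pM2l//.
  by rewrite ler_pdivrMl// (le_trans h3)// expr2; lra.
have := eM _ _ _ _ (Ex_amgm e0 (YL j) dW) (YM j) HWi.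
have := eM _ _ _ _ (Ex_amgm e0 (WL i) (dY j)) W2 (le_trans (Ye j) e2).
have := eM _ _ _ _ (Ex_amgm e0 (Y'L j) (dX' i)) (Y'M j) (le_trans (X'e i) e2).
have := eM _ _ _ _ (Ex_amgm e0 (sX'L i) (dY' j)) X'2 (le_trans (Y'e j) e2).
rewrite !ler_norml => /andP[? ?] /andP[? ?] /andP[? ?] /andP[? ?].
by apply/andP; split; lra.
Qed.

Lemma density (eta : R) : 0 < eta ->
  exists2 X, Xset P Y X & forall i j,
    `|Ex P (fun w => coord (X w) i * coord (Y w) j) -
      Ex mu (fun t => coord (X' t) i * coord (Y' t) j)| <= eta.
Proof.
move=> eta0.
pose M := \sum_i (Ex P (fun w => coord (Y w) i ^+ 2) +
  (Ex mu (fun t => coord (X' t) i ^+ 2) + Ex mu (fun t => coord (Y' t) i ^+ 2))).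
have MP i : Ex P (fun w => coord (Y w) i ^+ 2) +
  (Ex mu (fun t => coord (X' t) i ^+ 2) + Ex mu (fun t => coord (Y' t) i ^+ 2)) <= M.
  by rewrite /M [leRHS](bigD1 i)//= lerDl sumr_ge0// => j _; rewrite !addr_ge0 ?Ex_sqr_ge0.
have M0 : 0 <= M by apply: sumr_ge0 => i _; rewrite !addr_ge0 ?Ex_sqr_ge0.
have sq0 i := (Ex_sqr_ge0 P (fun w => coord (Y w) i),
  (Ex_sqr_ge0 mu (fun t => coord (X' t) i),
   Ex_sqr_ge0 mu (fun t => coord (Y' t) i))).
pose e := eta / (10 * M + 144).
have e0 : 0 < e by rewrite divr_gt0// ltr_wpDl// mulr_ge0.
have ee : 0 < e ^+ 2 by exact: exprn_gt0.
have [k _ /(_ k (leqnn k)) kP] : \forall k \near \oo, forall i,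
   [/\ Ex P (fun w => (coord (Y w) i - srnd k (coord (Y w) i)) ^+ 2) <= e ^+ 2,
       Ex mu (fun t => (coord (X' t) i - srnd k (coord (X' t) i)) ^+ 2) <= e ^+ 2 &
       Ex mu (fun t => (coord (Y' t) i - srnd k (coord (Y' t) i)) ^+ 2) <= e ^+ 2].
  apply: filter_forall => i.
  have h1 := Ex_srnd_err (YL i) ee; have h2 := Ex_srnd_err (X'L i) ee.
  have h3 := Ex_srnd_err (Y'L i) ee.
  by apply: filterS3 h1 h2 h3 => k.
have [X XX Xe] := @density_step k e M e0
  (fun i => ltac:(have := MP i; have [? [? ?]] := sq0 i; lra))
  (fun i => ltac:(have := MP i; have [? [? ?]] := sq0 i; lra))
  (fun i => ltac:(have := MP i; have [? [? ?]] := sq0 i; lra))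
  (fun i => let: And3 h _ _ := kP i in h) (fun i => let: And3 _ h _ := kP i in h)
  (fun i => let: And3 _ _ h := kP i in h).
exists X => // i j; apply: (le_trans (Xe i j)).
rewrite /e mulrAC ler_pdivrMr ?ltr_wpDl ?mulr_ge0// ler_pM2l//; lra.
Qed.

End density.

Section law_expectation.
Context {dT dU : measure_display} {T : measurableType dT} {U : measurableType dU}.
Context {R : realType}.
Variables (P : probability T R) (Z : {mfun T >-> U}).

Lemma itg_law (f : U -> R) : measurable_fun setT f -> itg P (f \o Z) ->
  itg (distribution P Z) f.
Proof.
move=> mf fi; apply/integrableP; split; first exact/measurable_EFinP.
rewrite ge0_integral_distribution//=; last exact/measurable_EFinP/measurableT_comp.
by have /integrableP[] := fi.
Qed.

Lemma Ex_law (f : U -> R) : measurable_fun setT f -> itg P (f \o Z) ->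
  Ex (distribution P Z) f = Ex P (f \o Z).
Proof.
move=> mf fi; congr fine; rewrite integral_distribution//.
exact/measurable_EFinP.
Qed.

Lemma L2_law (f : U -> R) : measurable_fun setT f -> L2 P (f \o Z) ->
  L2 (distribution P Z) f.
Proof.
by move=> mf fL; split=> //; apply: itg_law; [exact: measurable_funX|exact: fL.2].
Qed.

End law_expectation.

Lemma sqr_sum_le {R : realType} (I : Type) (s : seq I) (a : I -> R) :
  (\sum_(i <- s) a i) ^+ 2 <= 2 ^+ size s * \sum_(i <- s) a i ^+ 2.
Proof.
elim: s => [|i s ih]; first by rewrite !big_nil expr0n mulr0.
rewrite !big_cons /= [2 ^+ _.+1]exprS.
have s0 : 0 <= \sum_(i <- s) a i ^+ 2 by apply: sumr_ge0 => j _; exact: sqr_ge0.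
have p1 : 1 <= 2 ^+ size s :> R by rewrite exprn_ege1// ler1n.
have := sqr_ge0 (a i - \sum_(i <- s) a i); have := sqr_ge0 (a i).
move: (\sum_(i <- s) a i) (\sum_(i <- s) a i ^+ 2) (2 ^+ size s) ih s0 p1 => S Q p ih Q0 p1 a0 h.
have ap : a i ^+ 2 <= p * a i ^+ 2 by rewrite ler_peMl.
apply: (@le_trans _ _ (2 * (a i ^+ 2 + S ^+ 2))); first by lra.
by rewrite -mulrA ler_pM2l// mulrDr lerD.
Qed.

Section signed_vectors.
Context {R : realType} {d : nat}.

(* Index (s, i, b): the signed part b of the i-th coordinate of x (s = true)
   or of y (s = false). *)
Definition idx : finType := (bool * 'I_d * bool)%type.

Definition vec_of (s : bool) (z : idx -> R) : d.-tuple R :=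
  [tuple z (s, i, true) - z (s, i, false) | i < d].

Lemma coord_vec_of s z i : coord (vec_of s z) i = z (s, i, true) - z (s, i, false).
Proof. by rewrite /coord tnth_mktuple. Qed.

Lemma measurable_vec_of s dT (T : measurableType dT) (z : idx -> T -> R) :
  (forall p, measurable_fun setT (z p)) ->
  measurable_fun setT (fun x => vec_of s (z ^~ x)).
Proof.
move=> mz; apply/measurable_fun_tnthP => i.
rewrite (_ : _ \o _ = fun x => z (s, i, true) x - z (s, i, false) x).
  exact: measurable_funB.
by apply/funext => x; rewrite /= tnth_mktuple.
Qed.

Lemma coord_vec_of_le s z i : (forall p, 0 <= z p) ->
  `|coord (vec_of s z) i| <= \sum_p z p.
Proof.
move=> z0; rewrite coord_vec_of (bigD1 (s, i, true))//= (bigD1 (s, i, false))/=; last first.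
  by rewrite xpair_eqE andbF.
have r0 : 0 <= \sum_(p : idx | (p != (s, i, true)) && (p != (s, i, false))) z p.
  by apply: sumr_ge0.
have := z0 (s, i, true); have := z0 (s, i, false).
rewrite ler_norml; move: r0; move: (\sum_(p | _) _) => r; move=> *.
by apply/andP; split; lra.
Qed.

Lemma coord_vec_of_lip s z z' i : (forall p, 0 <= z' p <= z p) ->
  `|coord (vec_of s z) i - coord (vec_of s z') i| <= \sum_p (z p - z' p).
Proof.
move=> zz'; rewrite (_ : _ - _ = coord (vec_of s (fun p => z p - z' p)) i).
  by apply: coord_vec_of_le => p; have /andP[_] := zz' p; rewrite subr_ge0.
by rewrite !coord_vec_of; ring.
Qed.

Let sum_gap_ge0 (z z' : idx -> R) : (forall p, 0 <= z' p <= z p) ->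
  0 <= \sum_p (z p - z' p).
Proof.
by move=> zz'; apply: sumr_ge0 => p _; have /andP[] := zz' p; rewrite subr_ge0.
Qed.

Lemma pseudo_lipschitz_mul i j : pseudo_lipschitz 2
  (fun z => coord (vec_of true z) i * coord (vec_of false z) j).
Proof.
split=> //; last first.
  move=> dT T z mz; apply: measurable_funM; apply: measurable_coord; exact: measurable_vec_of.
move=> z z' zz'.
have z0 p : 0 <= z p by have /andP[] := zz' p; exact: le_trans.
have z'0 p : 0 <= z' p by have /andP[] := zz' p.
have Szz' : \sum_p z' p <= \sum_p z p by apply: ler_sum => p _; have /andP[] := zz' p.
have := coord_vec_of_le true i z0; have := coord_vec_of_le false j z'0.
have := coord_vec_of_lip true i zz'; have := coord_vec_of_lip false j zz'.
have D0 : 0 <= \sum_p (z p - z' p) by exact: sum_gap_ge0.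
have S0 : 0 <= \sum_p z p by apply: sumr_ge0.
move: (\sum_p (z p - z' p)) (\sum_p z p) (\sum_p z' p) D0 S0 Szz' => D S S' D0 S0 SS'.
move: (coord (vec_of true z) i) (coord (vec_of true z') i) => x x'.
move: (coord (vec_of false z) j) (coord (vec_of false z') j) => y y' hy hx hy' hx'.
rewrite (_ : _ - _ = x * (y - y') + (x - x') * y'); last by ring.
apply: (le_trans (ler_normD _ _)); rewrite !normrM.
have : `|x| * `|y - y'| <= S * D by apply: ler_pM.
have : `|x - x'| * `|y'| <= D * S' by apply: ler_pM.
nra.
Qed.

Lemma hat_vec_of_lip s n a z z' : (forall p, 0 <= z' p <= z p) ->
  `|hat n a (vec_of s z) - hat n a (vec_of s z')| <= n%:R * d%:R * \sum_p (z p - z' p).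
Proof.
move=> zz'; apply: (le_trans (hat_lip _ _ _ _)); rewrite -mulrA ler_wpM2l//.
rewrite mulr_natl -[X in _ *+ X]card_ord -sumr_const; apply: ler_sum => i _.
exact: coord_vec_of_lip.
Qed.

Lemma measurable_hat_vec_of s n a dT (T : measurableType dT) (z : idx -> T -> R) :
  (forall p, measurable_fun setT (z p)) ->
  measurable_fun setT (fun x => hat n a (vec_of s (z ^~ x))).
Proof.
by move=> mz; exact: (measurableT_comp (measurable_hat n a) (measurable_vec_of s mz)).
Qed.

Lemma pseudo_lipschitz_hat n a : pseudo_lipschitz (n%:R * d%:R)
  (fun z => hat n a (vec_of false z)).
Proof.
split=> [||dT T z mz]; [by rewrite mulr_ge0| |exact: measurable_hat_vec_of].
move=> z z' zz'; apply: (le_trans (hat_vec_of_lip _ _ _ zz')).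
have z0 p : 0 <= z p by have /andP[] := zz' p; exact: le_trans.
have D0 : 0 <= \sum_p (z p - z' p) by exact: sum_gap_ge0.
by rewrite ler_wpM2l ?mulr_ge0// ler_peMl// lerDl sumr_ge0.
Qed.

Lemma pseudo_lipschitz_hat_diff n a i : pseudo_lipschitz (2 + 2 * (n%:R * d%:R))
  (fun z => hat n a (vec_of true z) * (coord (vec_of false z) i - coord (vec_of true z) i)).
Proof.
have nd0 : 0 <= n%:R * d%:R :> R by rewrite mulr_ge0.
split=> [||dT T z mz]; first by lra.
- move=> z z' zz'.
  have z0 p : 0 <= z p by have /andP[] := zz' p; exact: le_trans.
  have z'0 p : 0 <= z' p by have /andP[] := zz' p.
  have Szz' : \sum_p z' p <= \sum_p z p by apply: ler_sum => p _; have /andP[] := zz' p.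
  have := coord_vec_of_le true i z'0; have := coord_vec_of_le false i z'0.
  have := coord_vec_of_lip true i zz'; have := coord_vec_of_lip false i zz'.
  have := hat_vec_of_lip true n a zz'.
  have := hat_ge0 n a (vec_of true z); have := hat_le1 n a (vec_of true z).
  have D0 : 0 <= \sum_p (z p - z' p) by exact: sum_gap_ge0.
  have S0 : 0 <= \sum_p z p by apply: sumr_ge0.
  move: (\sum_p (z p - z' p)) (\sum_p z p) (\sum_p z' p) D0 S0 Szz' => D S S' D0 S0 SS'.
  move: (hat n a (vec_of true z)) (hat n a (vec_of true z')) (n%:R * d%:R) nd0 => h h' c c0.
  move: (coord (vec_of true z) i) (coord (vec_of true z') i) => x x'.
  move: (coord (vec_of false z) i) (coord (vec_of false z') i) => y y' h1 h0 hh hy hx hy' hx'.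
  rewrite (_ : _ - _ = h * ((y - y') - (x - x')) + (h - h') * (y' - x')); last by ring.
  apply: (le_trans (ler_normD _ _)); rewrite !normrM (ger0_norm h0).
  have a1 : `|y - y' - (x - x')| <= D + D by rewrite (le_trans (ler_normB _ _))// lerD.
  have a2 : `|y' - x'| <= S' + S' by rewrite (le_trans (ler_normB _ _))// lerD.
  have : h * `|y - y' - (x - x')| <= 1 * (D + D) by apply: ler_pM.
  have : `|h - h'| * `|y' - x'| <= (c * D) * (S' + S') by apply: ler_pM.
  have cD0 : 0 <= c * D by rewrite mulr_ge0.
  have : 0 <= D * S by rewrite mulr_ge0.
  have : (c * D) * S' <= (c * D) * S by rewrite ler_wpM2l.
  nra.
- apply: measurable_funM; first exact: measurable_hat_vec_of.
  by apply: measurable_funB; apply: measurable_coord; exact: measurable_vec_of.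
Qed.

End signed_vectors.

Lemma martingale_coord {dT} {T : measurableType dT} {R : realType} {d : nat}
    (P : probability T R) (X Y : T -> d.-tuple R) i (B : set R) :
  martingale_pair P X Y -> measurable B ->
  Ex P (fun w => \1_B (coord (X w) i) * (coord (Y w) i - coord (X w) i)) = 0.
Proof.
move=> XY mB; apply: (XY [set x | B (coord x i)] i).
have := @measurable_tnth _ R d i measurableT B mB; by rewrite setTI.
Qed.

Lemma martingale_Ex_sqr_le {dT} {T : measurableType dT} {R : realType} {d : nat}
    (P : probability T R) (X Y : T -> d.-tuple R) i :
  L2 P (fun w => coord (X w) i) -> L2 P (fun w => coord (Y w) i) ->
  martingale_pair P X Y ->
  Ex P (fun w => coord (X w) i ^+ 2) <= Ex P (fun w => coord (Y w) i ^+ 2).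
Proof.
move=> XL YL XY.
have := martingale_sqr_le XL YL (fun B => martingale_coord i XY) measurableT.
by under Ex_eq do rewrite indicT mul1r; under [leRHS]Ex_eq do rewrite indicT mul1r.
Qed.

Section limit_pair.
Context {R : realType} {d : nat} (L : (nat -> R) -> R).
Hypothesis HL : is_generalized_limit L.
Context {dO : measure_display} {Omega : measurableType dO}.
Variables (P : probability Omega R) (Y : Omega -> d.-tuple R).
Variable X : nat -> Omega -> d.-tuple R.
Hypotheses (mY : measurable_fun setT Y) (mX : forall n, measurable_fun setT (X n)).
Hypothesis YL : forall i, L2 P (fun w => coord (Y w) i).
Hypothesis XL : forall n i, L2 P (fun w => coord (X n w) i).
Hypothesis XY : forall n, martingale_pair P (X n) Y.

Let V n (s : bool) w := if s then X n w else Y w.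

Let Z n (p : @idx d) w : R := spart p.2 (coord (V n p.1.1 w) p.1.2).

Let VL n s i : L2 P (fun w => coord (V n s w) i).
Proof. by case: s; [exact: XL|exact: YL]. Qed.

Let VY n s : martingale_pair P (V n s) Y.
Proof.
case: s; first exact: XY.
by move=> B i mB; rewrite -[RHS](Ex_cst P); apply: Ex_eq => w; rewrite subrr mulr0.
Qed.

Let Z0 n p w : 0 <= Z n p w. Proof. exact: spart_ge0. Qed.

Let ZL n p : L2 P (Z n p).
Proof. by apply: L2_spart; exact: VL. Qed.

Let K := 2 + 2 * (2 ^+ size (index_enum (@idx d)) *
                  \sum_(p : @idx d) Ex P (fun w => coord (Y w) p.1.2 ^+ 2)).

Let ZK n : Ex P (fun w => (1 + \sum_p Z n p w) ^+ 2) <= K.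
Proof.
have sL : L2 P (fun w => \sum_p Z n p w) by exact: L2_sum.
apply: (@le_trans _ _ (Ex P (fun w => 2 + 2 * (2 ^+ size (index_enum (@idx d)) *
   \sum_p Z n p w ^+ 2)))).
  apply: Ex_le; first exact: (L2D (L2_cst P 1) sL).2.
    apply: itgD; first exact: itg_cst.
    by apply/itgZ/itgZ/itg_sum => p; exact: (ZL n p).2.
  move=> w; have := sqr_sum_le (index_enum (@idx d)) (fun p => Z n p w).
  have := sqr_ge0 (1 - \sum_p Z n p w); lra.
have i1 : itg P (fun w => \sum_p Z n p w ^+ 2) by apply: itg_sum => p; exact: (ZL n p).2.
rewrite ExD; [|exact: itg_cst|exact/itgZ/itgZ].
rewrite Ex_cst lerD2l ExZ ?ler_pM2l//; last exact: itgZ.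
rewrite ExZ// ler_pM2l ?exprn_gt0// Ex_sum; last by move=> p; exact: (ZL n p).2.
apply: ler_sum => p _.
apply: (le_trans _ (martingale_Ex_sqr_le (VL n p.1.1 p.1.2) (YL p.1.2) (VY n p.1.1))).
apply: Ex_le; [exact: (ZL n p).2|exact: (VL n _ _).2|].
move=> w; rewrite -[leRHS]real_normK ?num_real// ler_sqr ?nnegrE// spart_le//.
Qed.

Let ZU e : 0 < e -> exists k, forall n p,
  Ex P (fun w => (Z n p w - rnd k (Z n p w)) ^+ 2) <= e.
Proof.
move=> e0.
have [k _ /(_ k (leqnn k)) kP] := filter_forall _ (fun i => martingale_unif_rnd (YL i) e0).
exists k => n p.
apply: (kP p.1.2 (fun w => coord (V n p.1.1 w) p.1.2) p.2); first exact: VL.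
by move=> B mB; exact: martingale_coord.
Qed.

Let vecZ n s w : vec_of s (Z n ^~ w) = V n s w.
Proof. by apply: eq_from_tnth => i; rewrite tnth_mktuple /Z /= -spartE. Qed.

Lemma limit_pair : exists Xo Yo : measurableTypeR R -> d.-tuple R,
  [/\ measurable_fun setT Xo, measurable_fun setT Yo,
      forall i, L2 unif (fun u => coord (Xo u) i),
      forall i, L2 unif (fun u => coord (Yo u) i) &
  [/\ martingale_pair unif Xo Yo,
      forall B, measurable B -> unif (Yo @^-1` B) = P (Y @^-1` B) &
      forall i j, Ex unif (fun u => coord (Xo u) i * coord (Yo u) j) =
        L (fun n => Ex P (fun w => coord (X n w) i * coord (Y w) j))]].
Proof.
have [Zo [Zo0 ZoL ZoE]] := limit_family HL Z0 ZL ZK ZU.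
have mZo p := L2_measurable (ZoL p).
pose Vo s u := vec_of s (Zo ^~ u).
have mVo s : measurable_fun setT (Vo s) by exact: measurable_vec_of.
have VoL s i : L2 unif (fun u => coord (Vo s u) i).
  apply: L2_eq (L2B (ZoL (s, i, true)) (ZoL (s, i, false))) => u.
  by rewrite coord_vec_of.
exists (Vo true), (Vo false); split=> //; split.
- move=> B i mB.
  have i0 := itg_cst unif (0 : R).
  have iD := L2_itg (L2B (VoL false i) (VoL true i)).
  rewrite (@orthant_determined _ _ _ _ _ _ unif unif (Vo true) (Vo true) _ (fun=> 0) _ _ iD i0)//.
    by rewrite -[RHS](Ex_cst unif); apply: Ex_eq => u; rewrite mulr0.
  move=> n a; rewrite (ZoE _ _ (pseudo_lipschitz_hat_diff n a i)).
  transitivity (0 : R).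
    rewrite -[RHS](glim_cst HL); congr L; apply/funext => m.
    under Ex_eq do rewrite !vecZ /= mulrC.
    apply: (orthogonal_indic_fun (mX m) (L2B (YL i) (XL m i)) _ (measurable_hat n a)).
      by move=> C mC; exact: XY.
    apply: (@L2_bounded _ _ _ _ _ 1); first exact: (measurableT_comp (measurable_hat n a)).
    by move=> w /=; rewrite ger0_norm ?hat_ge0 ?hat_le1.
  by rewrite -[LHS](Ex_cst unif); apply: Ex_eq => u; rewrite mulr0.
- move=> B mB.
  have mVB : measurable (Vo false @^-1` B) by rewrite -[X in measurable X]setTI; exact: mVo.
  have mYB : measurable (Y @^-1` B) by rewrite -[X in measurable X]setTI; exact: mY.
  rewrite !prE//; congr EFin; rewrite /pr -!Ex_indic//.
  have i1 := itg_cst unif (1 : R); have i1' := itg_cst P (1 : R).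
  have := @orthant_determined _ _ _ _ _ _ unif P (Vo false) Y _ _ (mVo false) mY i1 i1'.
  have h n a : Ex unif (fun u => hat n a (Vo false u) * 1) = Ex P (fun w => hat n a (Y w) * 1).
    under Ex_eq do rewrite mulr1; under [RHS]Ex_eq do rewrite mulr1.
    rewrite (ZoE _ _ (pseudo_lipschitz_hat n a)) -[RHS](glim_cst HL).
    by congr L; apply/funext => m; apply: Ex_eq => w; rewrite vecZ.
  move=> /(_ h B mB).
  by under Ex_eq do rewrite mulr1; under [RHS]Ex_eq do rewrite mulr1.
- move=> i j; rewrite (ZoE _ _ (pseudo_lipschitz_mul i j)).
  by congr L; apply/funext => n; apply: Ex_eq => w; rewrite !vecZ.
Qed.

End limit_pair.

Lemma Gamma_martingale {R : realType} {d : nat} (nu : set (d.-tuple R) -> \bar R)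
    (g : probability (d.-tuple R * d.-tuple R)%type R) :
  Gamma nu g <->
  [/\ forall i, L2 g (fun z => coord z.1 i), forall i, L2 g (fun z => coord z.2 i),
      martingale_pair g fst snd &
      forall B, measurable B -> g (snd @^-1` B) = nu B].
Proof.
have m1 := @measurable_fst _ _ (d.-tuple R) (d.-tuple R).
have m2 := @measurable_snd _ _ (d.-tuple R) (d.-tuple R).
have sn0 (x : d.-tuple R) : 0 <= sqnorm x by apply: sumr_ge0 => i _; exact: sqr_ge0.
have msn (f : (d.-tuple R * d.-tuple R)%type -> d.-tuple R) : measurable_fun setT f ->
    measurable_fun setT (fun z => sqnorm (f z)).
  by move=> mf; apply: measurable_sum => i; apply: measurable_funX; exact: measurable_coord.
split=> [[g2 [gnu gm]]|[g1L g2L gm gnu]].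
  have i12 : itg g (fun z => sqnorm z.1 + sqnorm z.2).
    apply: itg_ge0 => //; last by move=> z; rewrite addr_ge0.
    by apply: measurable_funD; apply: msn.
  have i1 : itg g (fun z => sqnorm z.1).
    by apply: (itg_dom i12) => [|z]; [exact: msn|rewrite ger0_norm// lerDl].
  have i2 : itg g (fun z => sqnorm z.2).
    by apply: (itg_dom i12) => [|z]; [exact: msn|rewrite ger0_norm// lerDr].
  have g1L : forall i, L2 g (fun z => coord z.1 i).
    by apply/(L2vec_coordP g m1); rewrite ExE// ltry.
  have g2L : forall i, L2 g (fun z => coord z.2 i).
    by apply/(L2vec_coordP g m2); rewrite ExE// ltry.
  by split=> //; apply/(martingale_pairP m1).
split; last by split=> //; apply/(martingale_pairP m1).
have i12 : itg g (fun z => sqnorm z.1 + sqnorm z.2).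
  apply: itgD; apply: itg_sum => i; [exact: (g1L i).2|exact: (g2L i).2].
by rewrite ExE// ltry.
Qed.

Lemma Xset_martingale {R : realType} {d : nat} {dO} {Omega : measurableType dO}
    (P : probability Omega R) (X Y : Omega -> d.-tuple R) :
  (forall i, L2 P (fun w => coord (Y w) i)) -> Xset P Y X ->
  [/\ measurable_fun setT X, forall i, L2 P (fun w => coord (X w) i) &
      martingale_pair P X Y].
Proof.
move=> YL [[mX X2] [_ XY]]; have XL := (L2vec_coordP P mX).1 X2.
by split=> //; apply/(martingale_pairP mX).
Qed.

Theorem theorem1 (R : realType) (dO : measure_display) (Omega : measurableType dO)
  (P : probability Omega R) (d m : nat) (S : 'M[R]_d)
  (Y : Omega -> d.-tuple R) :
  sym_inv_index m S ->
  L2vec P Y ->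
  atomless (law P Y) ->
  exists2 g0 : probability (d.-tuple R * d.-tuple R)%type R,
    Gamma (law P Y) g0 &
    (forall g, Gamma (law P Y) g ->
       (\int[g]_z (Sform S z.1 z.2)%:E <= \int[g0]_z (Sform S z.1 z.2)%:E)%E) /\
    ereal_sup [set (\int[P]_w (Sform S (X w) (Y w))%:E)%E | X in Xset P Y]
      = (\int[g0]_z (Sform S z.1 z.2)%:E)%E.
Proof.
move=> _ [mY Y2] Yna; have YL := (L2vec_coordP P mY).1 Y2.
pose val X := Ex P (fun w => Sform S (X w) (Y w)).
have XP X : Xset P Y X -> [/\ measurable_fun setT X,
    forall i, L2 P (fun w => coord (X w) i) & martingale_pair P X Y].
  exact: Xset_martingale.
have valE X : Xset P Y X -> (\int[P]_w (Sform S (X w) (Y w))%:E = (val X)%:E)%E.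
  by move=> /XP[_ XL _]; rewrite ExE//; have [] := Ex_Sform S XL YL.
have val_sum X : Xset P Y X ->
    val X = \sum_i \sum_j S i j * Ex P (fun w => coord (X w) i * coord (Y w) j).
  by move=> /XP[_ XL _]; have [] := Ex_Sform S XL YL.
pose bnd i j := Ex P (fun w => coord (Y w) i ^+ 2) + Ex P (fun w => coord (Y w) j ^+ 2).
have XY_bnd X i j : Xset P Y X ->
    `|Ex P (fun w => coord (X w) i * coord (Y w) j)| <= bnd i j.
  move=> /XP[_ XL XY]; apply: (le_trans (Ex_amgm ltr01 (XL i) (YL j))).
  by rewrite invr1 !mul1r lerD2r martingale_Ex_sqr_le.
pose A := [set val X | X in Xset P Y].
have A_ub : has_ubound A.
  exists (\sum_i \sum_j `|S i j| * bnd i j) => _ [X XX <-]; rewrite val_sum//.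
  apply: ler_sum => i _; apply: ler_sum => j _; apply: (le_trans (ler_norm _)).
  by rewrite normrM ler_wpM2l// XY_bnd.
have YY : Xset P Y Y.
  split=> //; split=> [B mB|B i mB//]; exists B => //.
  by rewrite setTI.
have A0 : A !=set0 by exists (val Y), Y.
have supE : ereal_sup [set (\int[P]_w (Sform S (X w) (Y w))%:E)%E | X in Xset P Y] = (sup A)%:E.
  rewrite -ereal_sup_EFin// /A image_comp; congr ereal_sup.
  by apply/seteqP; split=> _ [X XX <-]; exists X => //; rewrite /= valE.
have [L HL] := generalized_limit_exists R.
have /choice[X XnP] n : exists X, Xset P Y X /\ sup A - n.+1%:R^-1 < val X.
  have [_ [X XX <-] h] := @sup_adherent _ A n.+1%:R^-1 (ltac:(by rewrite invr_gt0)) (conj A0 A_ub).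
  by exists X.
have valL : L (fun n => val (X n)) = sup A.
  apply: (glim_cvg HL).
  apply: (@squeeze_cvgr _ _ _ _ (fun n => sup A - n.+1%:R^-1) (fun=> sup A)).
  - apply: nearW => n; have [XX h] := XnP n; rewrite (ltW h)/=.
    by apply: ub_le_sup => //; exists (X n).
  - rewrite -[X in _ --> X]subr0; apply: cvgB; first exact: cvg_cst.
    exact: cvg_harmonic.
  - exact: cvg_cst.
have XnXP n := XP _ (XnP n).1.
have [Xo [Yo [mXo mYo XoL YoL [XYo Yo_law XoYo]]]] :=
  limit_pair HL mY (fun n => let: And3 h _ _ := XnXP n in h) YL
    (fun n => let: And3 _ h _ := XnXP n in h) (fun n => let: And3 _ _ h := XnXP n in h).
pose Zo u := (Xo u, Yo u).
have mZo : measurable_fun setT Zo by exact: measurable_fun_pair.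
pose Zf : {mfun measurableTypeR R >-> (d.-tuple R * d.-tuple R)%type} :=
  MeasurableFun.Pack (MeasurableFun.Class (isMeasurableFun.Build _ _ _ _ _ mZo)).
pose g0 : probability (d.-tuple R * d.-tuple R)%type R := distribution unif Zf.
have m1 := @measurable_fst _ _ (d.-tuple R) (d.-tuple R).
have m2 := @measurable_snd _ _ (d.-tuple R) (d.-tuple R).
have g1L i : L2 g0 (fun z => coord z.1 i).
  by apply: L2_law; [exact: measurable_coord|exact: XoL].
have g2L i : L2 g0 (fun z => coord z.2 i).
  by apply: L2_law; [exact: measurable_coord|exact: YoL].
have G0 : Gamma (law P Y) g0.
  apply/Gamma_martingale; split=> // B i mB.
  rewrite -(XYo B i mB); apply: Ex_law.
    apply: measurable_funM; first exact: measurable_indic_comp.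
    by apply: measurable_funB; exact: measurable_coord.
  have mXB : measurable (Xo @^-1` B) by rewrite -[X in measurable X]setTI; exact: mXo.
  exact: (itg_indicM mXB (L2_itg (L2B (YoL i) (XoL i)))).
have g0E : (\int[g0]_z (Sform S z.1 z.2)%:E = (sup A)%:E)%E.
  have [iS e] := Ex_Sform S g1L g2L; rewrite ExE// e -valL; congr EFin.
  have bXY i j : bounded_seq (fun n => S i j * Ex P (fun w => coord (X n w) i * coord (Y w) j)).
    by apply: bounded_seqZ; exists (bnd i j) => n; apply: XY_bnd; exact: (XnP n).1.
  have -> : (fun n => val (X n)) = fun n => \sum_i \sum_j
      S i j * Ex P (fun w => coord (X n w) i * coord (Y w) j).
    by apply/funext => n; rewrite val_sum//; exact: (XnP n).1.
  rewrite (glim_sum HL); last by move=> i; exact: bounded_seq_sum.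
  apply: eq_bigr => i _; rewrite (glim_sum HL)//; apply: eq_bigr => j _.
  rewrite (glimZ HL); last by exists (bnd i j) => n; apply: XY_bnd; exact: (XnP n).1.
  rewrite -XoYo; congr (_ * _); apply: Ex_law; last exact: (itg_sqrM (XoL i) (YoL j)).
  by apply: measurable_funM; exact: measurable_coord.
exists g0 => //; split; last by rewrite supE g0E.
move=> g /Gamma_martingale[gL1 gL2 gm gnu]; rewrite g0E.
have [iS gE] := Ex_Sform S gL1 gL2.
rewrite ExE// lee_fin gE.
apply/ler_addgt0Pl => e e0.
pose s := \sum_i \sum_j `|S i j|.
have s0 : 0 <= s by apply: sumr_ge0 => i _; apply: sumr_ge0.
have eta0 : 0 < e / (s + 1) by rewrite divr_gt0// ltr_wpDl.
have [W WX We] := density m1 m2 mY gL1 gL2 YL gnu gm Yna eta0.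
have WA : val W <= sup A by apply: ub_le_sup => //; exists W.
apply: (@le_trans _ _ (e + val W)); last by rewrite lerD2l.
rewrite val_sum// -lerBlDr -sumrB.
apply: (@le_trans _ _ (\sum_i \sum_j `|S i j| * (e / (s + 1)))).
  apply: ler_sum => i _; rewrite -sumrB; apply: ler_sum => j _.
  rewrite -mulrBr (le_trans (ler_norm _))// normrM ler_wpM2l// distrC.
  exact: We.
under eq_bigr do rewrite -mulr_suml.
rewrite -mulr_suml -/s mulrCA ler_piMr ?(ltW e0)//.
by rewrite ler_pdivrMr ?ltr_wpDl// mul1r lerDl.
Qed.
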